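(* Let $X$ be a predual of $\ell_1$, i.e. a real Banach space whose dual $X^*$ is isometric to $\ell_1$ (and identify $X^*$ with $\ell_1$). Then $X$ contains an isometric copy of $c$ if and only if there exist $\bar x\in S_X$ and a sequence $\{v_n^*\}_{n=1}^\infty\subseteq\operatorname{ext} B_{X^*}$ such that, for some $\bar x^*\in X^*$, (i) $v_n^*\to\bar x^*$ in the $\sigma(X^*,X)$-topology as $n\to\infty$; (ii) $v_n^*(\bar x)=\bar x^*(\bar x)=1$ for every $n\in\mathbb N$; (iii) $\operatorname{supp}(v_n^* )\cap\operatorname{supp}(d^* )=\emptyset$ for every $n\in\mathbb N$ and for all $d^*\in(\operatorname{ext} D(\bar x))'$.
   Context: All spaces are real. $c$ is the space of convergent sequences with the sup norm. $B_Z$ and $S_Z$ are the closed unit ball and unit sphere of a Banach space $Z$; $\operatorname{ext} K$ is the set of extreme points of a convex set $K$. For $x\in S_X$, $D(x)=\{x^*\in S_{X^*}: x^*(x)=1\}$. For $A\subseteq X^*$, $A'$ denotes the set of $\sigma(X^*,X)$-cluster points of $A$, where $\sigma(X^*,X)$ is the weak* topology on $X^*$ induced by $X$. For $x^*\in\ell_1$, $\operatorname{supp}(x^* )=\{i\in\mathbb N: x^*(i)\neq 0\}$.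
   Formalization: The sequence v_n^* is required to consist of pairwise distinct extreme points; with repetitions allowed the claim fails, e.g. X = c_0, x̄ = e_1, v_n^* = x̄^* = e_1^* for all n satisfies (i)–(iii) since (ext D(x̄))' is empty, yet c_0 contains no isometric copy of c. *)

(* Defs.v *)
From HB Require Import structures.
From mathcomp Require Import all_boot all_order all_algebra.
From mathcomp Require Import all_classical all_reals all_analysis.
Import Order.TTheory GRing.Theory Num.Theory.
Import numFieldNormedType.Exports.

Set Implicit Arguments.
Unset Strict Implicit.
Unset Printing Implicit Defensive.

Local Open Scope classical_set_scope.
Local Open Scope ring_scope.

Definition extreme_points (R : realType) (E : lmodType R) (K : set E) : set E :=
  [set x | K x /\
    forall (y z : E) (t : R), K y -> K z -> 0 < t -> t < 1 ->
      x = t *: y + (1 - t) *: z -> y = x /\ z = x].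

Definition unit_ball (R : realType) (E : normedModType R) : set E :=
  [set x | `|x| <= 1].

Definition unit_sphere (R : realType) (E : normedModType R) : set E :=
  [set x | `|x| = 1].

Definition isometric (R : realType) (E F : normedModType R)
    (T : {linear E -> F}) : Prop :=
  forall x, `|T x| = `|x|.

Arguments unit_ball {R} E.
Arguments unit_sphere {R} E.

Section SupLemmas.
Variable R : realType.

Lemma sup_ge (A : set R) (M x : R) :
  (forall a, A a -> a <= M) -> A x -> x <= sup A.
Proof. by move=> AM Ax; apply: ub_le_sup => //; exists M. Qed.

Lemma sup_le (A : set R) (M : R) :
  A !=set0 -> (forall a, A a -> a <= M) -> sup A <= M.
Proof. by move=> A0 AM; apply: ge_sup. Qed.

Lemma sup_homogeneous (V : lmodType R) (N : V -> R) :
  (forall v, 0 <= N v) -> (forall (l : R) v, N (l *: v) <= `|l| * N v) ->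
  forall (l : R) v, N (l *: v) = `|l| * N v.
Proof.
move=> N0 Nle l v; have [->|l0] := eqVneq l 0.
  by rewrite normr0 mul0r; apply/eqP; rewrite eq_le N0 andbT;
     rewrite (le_trans (Nle _ _))// normr0 mul0r.
apply/eqP; rewrite eq_le Nle/= -ler_pdivlMl ?normr_gt0//.
by rewrite -normfV -{1}(scale1r v) -(mulVf l0) -scalerA Nle.
Qed.

End SupLemmas.

Section Dual.
Variables (R : realType) (X : normedModType R).

Definition continuous_functional : {pred X -> R^o} :=
  [pred f | `[< linear (f : X -> R^o) /\ continuous (f : X -> R^o) >]].

Lemma continuous_functionalP (f : X -> R^o) :
  reflect (linear f /\ continuous f) (f \in continuous_functional).
Proof. exact: asboolP. Qed.

Lemma continuous_functional_submod : submod_closed continuous_functional.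
Proof.
split.
  apply/continuous_functionalP; split; last exact: cst_continuous.
  by move=> a u v /=; rewrite [RHS]addr0 scaler0.
move=> a f g /continuous_functionalP[lf cf] /continuous_functionalP[lg cg].
apply/continuous_functionalP; split.
  move=> k u v; rewrite -[LHS]/(a *: f (k *: u + v) + g (k *: u + v)).
  rewrite -[RHS]/(k *: (a *: f u + g u) + (a *: f v + g v)) lf lg.
  rewrite !scalerDr !scalerA (mulrC a) -!addrA; congr (_ + _).
  by rewrite addrCA.
by move=> x; apply: cvgD; [apply: cvgZl_tmp; exact: cf|exact: cg].
Qed.

HB.instance Definition _ := GRing.isSubmodClosed.Build R (X -> R^o)
  continuous_functional continuous_functional_submod.

Record dual : Type := Dual {
  dual_fun :> X -> R^o;
  _ : dual_fun \in continuous_functional }.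

HB.instance Definition _ := [isSub for dual_fun].
HB.instance Definition _ := [Choice of dual by <:].
HB.instance Definition _ := [SubChoice_isSubLmodule of dual by <:].

Lemma dual_linear (f : dual) : linear f.
Proof. by case: f => f /= /continuous_functionalP[]. Qed.

HB.instance Definition _ (f : dual) :=
  GRing.isLinear.Build R X R^o _ f (dual_linear f).

Lemma dual_continuous (f : dual) : continuous f.
Proof. by case: f => f /= /continuous_functionalP[]. Qed.

Lemma dualP (f g : dual) : f =1 g -> f = g.
Proof. by move=> fg; apply: val_inj; apply/funext. Qed.

Lemma dualDE (f g : dual) x : (f + g) x = f x + g x. Proof. by []. Qed.
Lemma dualZE (a : R) (f : dual) x : (a *: f) x = a * f x. Proof. by []. Qed.

Definition dual_norm (f : dual) : R := sup [set `|f x| | x in unit_ball X].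

Lemma dual_bounded (f : dual) :
  exists M, forall a, [set `|f x| | x in unit_ball X] a -> a <= M.
Proof.
have /linear_bounded_continuous/bounded_funP/(_ 1)[M fM] := @dual_continuous f.
by exists M => _ [x x1 <-]; exact: fM.
Qed.

Lemma dual_norm_ub (f : dual) x : `|x| <= 1 -> `|f x| <= dual_norm f.
Proof. by move=> x1; have [M fM] := dual_bounded f; apply: sup_ge fM _; exists x. Qed.

Lemma dual_norm_le (f : dual) M :
  (forall x, `|x| <= 1 -> `|f x| <= M) -> dual_norm f <= M.
Proof.
move=> fM; apply: sup_le => [|_ [x x1 <-]]; last exact: fM.
by exists `|f 0|, 0 => //; rewrite /unit_ball/= normr0.
Qed.

Lemma dual_norm_ge0 (f : dual) : 0 <= dual_norm f.
Proof. by apply: le_trans (@dual_norm_ub f 0 _); rewrite ?normr0. Qed.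

Lemma dual_normD (f g : dual) : dual_norm (f + g) <= dual_norm f + dual_norm g.
Proof.
apply: dual_norm_le => x x1; rewrite dualDE (le_trans (ler_normD _ _))//.
by rewrite lerD// dual_norm_ub.
Qed.

Lemma dual_normZ (l : R) (f : dual) : dual_norm (l *: f) = `|l| * dual_norm f.
Proof.
apply: sup_homogeneous => [|k g]; first exact: dual_norm_ge0.
by apply: dual_norm_le => x x1; rewrite dualZE normrM ler_wpM2l// dual_norm_ub.
Qed.

Lemma dual_norm0_eq0 (f : dual) : dual_norm f = 0 -> f = 0.
Proof.
move=> f0; apply: dualP => x; rewrite [RHS]/=.
have [->|x0] := eqVneq x 0; first by rewrite linear0.
have nx : `|x| != 0 by rewrite normr_eq0.
have := @dual_norm_ub f (`|x|^-1 *: x).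
rewrite f0 normrZ normfV normr_id mulVf// lexx => /(_ isT).
by rewrite normr_le0 linearZ/= scaler_eq0 invr_eq0 (negbTE nx)/= => /eqP.
Qed.

HB.instance Definition _ :=
  Lmodule_isNormed.Build R dual dual_normD dual_normZ dual_norm0_eq0.

(* The dual carrying sigma(X^*, X), i.e. the topology of pointwise convergence;
   the type dual itself carries the norm topology. *)
Definition weak_star : Type :=
  initial_topology (fun f : dual => (f : {ptws X -> R^o})).

HB.instance Definition _ := Topological.on weak_star.

Definition weak_star_cvg (v : nat -> dual) (f : dual) : Prop :=
  (v : nat -> weak_star) @ \oo --> (f : weak_star).

(* The set A' of sigma(X^*, X)-cluster points of A: every weak* neighbourhood
   of such a point contains an element of A different from it. *)
Definition weak_star_cluster_points (A : set dual) : set dual :=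
  @limit_point weak_star A.

(* D(x), which for |x| = 1 is the set of norming functionals of x. *)
Definition norming (x : X) : set dual :=
  [set f | unit_sphere dual f /\ f x = 1].

End Dual.

Section L1.
Variable R : realType.

Definition summable_seq : {pred nat -> R^o} :=
  [pred a | `[< cvgn (series (fun n => `|a n| : R^o)) >]].

Lemma summable_seqP (a : nat -> R^o) :
  reflect (cvgn (series (fun n => `|a n| : R^o))) (a \in summable_seq).
Proof. exact: asboolP. Qed.

Lemma summable_seq_submod : submod_closed summable_seq.
Proof.
split.
  apply/summable_seqP; rewrite (_ : series _ = cst 0); first exact: is_cvg_cst.
  by apply/funext => n; rewrite /series/= big1// => i _; rewrite normr0.
move=> k a b /summable_seqP ca /summable_seqP cb; apply/summable_seqP.
apply: (@series_le_cvg R _ (fun n => `|k| * `|a n| + `|b n|)) => //.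
- move=> n /=; rewrite -[(k *: a + b) n]/(k * a n + b n) -normrM.
  exact: ler_normD.
- rewrite -[X in series X]/((fun n => `|k| * `|a n|) + (fun n => `|b n|)).
  apply: is_cvg_seriesD => //.
  exact: (@is_cvg_seriesZ R (fun n => `|a n|) `|k| ca).
Qed.

HB.instance Definition _ := GRing.isSubmodClosed.Build R (nat -> R^o)
  summable_seq summable_seq_submod.

Record l1 : Type := L1 {
  l1_seq :> nat -> R^o;
  _ : l1_seq \in summable_seq }.

HB.instance Definition _ := [isSub for l1_seq].
HB.instance Definition _ := [Choice of l1 by <:].
HB.instance Definition _ := [SubChoice_isSubLmodule of l1 by <:].

Lemma l1_summable (a : l1) : cvgn (series (fun n => `|a n| : R^o)).
Proof. by case: a => a /= /summable_seqP. Qed.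

Lemma l1P (a b : l1) : a =1 b -> a = b.
Proof. by move=> ab; apply: val_inj; apply/funext. Qed.

Definition l1_norm (a : l1) : R := limn (series (fun n => `|a n| : R^o)).

Lemma l1_norm_ge (a : l1) n : series (fun n => `|a n| : R^o) n <= l1_norm a.
Proof.
apply: nondecreasing_cvgn_le; last exact: l1_summable.
by apply/nondecreasing_seqP => m; rewrite !seriesEnat/= big_nat_recr//= lerDl.
Qed.

Lemma l1_norm_le (a : l1) M :
  (forall n, series (fun n => `|a n| : R^o) n <= M) -> l1_norm a <= M.
Proof.
by move=> aM; apply: limr_le; [exact: l1_summable|near=> n; exact: aM].
Unshelve. all: by end_near. Qed.

Lemma l1_norm_ge0 (a : l1) : 0 <= l1_norm a.
Proof.
by apply: le_trans (l1_norm_ge a 0%N); rewrite /series/= big_nil.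
Qed.

Lemma l1_normD (a b : l1) : l1_norm (a + b) <= l1_norm a + l1_norm b.
Proof.
apply: l1_norm_le => n; apply: le_trans (lerD (l1_norm_ge a n) (l1_norm_ge b n)).
by rewrite /series/= -big_split/= ler_sum// => i _; exact: ler_normD.
Qed.

Lemma l1_normZ (l : R) (a : l1) : l1_norm (l *: a) = `|l| * l1_norm a.
Proof.
apply: sup_homogeneous => [|k b]; first exact: l1_norm_ge0.
apply: l1_norm_le => n; apply: le_trans (ler_wpM2l (normr_ge0 k) (l1_norm_ge b n)).
by rewrite /series/= mulr_sumr ler_sum// => i _; rewrite -normrM.
Qed.

Lemma l1_norm0_eq0 (a : l1) : l1_norm a = 0 -> a = 0.
Proof.
move=> a0; apply: l1P => n; rewrite [RHS]/=.
apply/eqP; rewrite -normr_le0 -a0; apply: le_trans (l1_norm_ge a n.+1).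
by rewrite /series/= big_nat_recr//= lerDr sumr_ge0.
Qed.

HB.instance Definition _ :=
  Lmodule_isNormed.Build R l1 l1_normD l1_normZ l1_norm0_eq0.

Definition supp (a : l1) : set nat := [set i | a i != 0].

End L1.

Section ConvergentSequences.
Variable R : realType.

Definition convergent_seq : {pred nat -> R^o} := [pred u | `[< cvgn u >]].

Lemma convergent_seqP (u : nat -> R^o) :
  reflect (cvgn u) (u \in convergent_seq).
Proof. exact: asboolP. Qed.

Lemma convergent_seq_submod : submod_closed convergent_seq.
Proof.
split; first by apply/convergent_seqP; exact: is_cvg_cst.
move=> k u v /convergent_seqP cu /convergent_seqP cv; apply/convergent_seqP.
by apply: is_cvgD => //; exact: is_cvgZr.
Qed.

HB.instance Definition _ := GRing.isSubmodClosed.Build R (nat -> R^o)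
  convergent_seq convergent_seq_submod.

(* The space c. *)
Record cseq : Type := Cseq {
  cseq_seq :> nat -> R^o;
  _ : cseq_seq \in convergent_seq }.

HB.instance Definition _ := [isSub for cseq_seq].
HB.instance Definition _ := [Choice of cseq by <:].
HB.instance Definition _ := [SubChoice_isSubLmodule of cseq by <:].

Lemma cseq_cvg (u : cseq) : cvgn u.
Proof. by case: u => u /= /convergent_seqP. Qed.

Lemma cseqP (u v : cseq) : u =1 v -> u = v.
Proof. by move=> uv; apply: val_inj; apply/funext. Qed.

Definition cseq_norm (u : cseq) : R := sup (range (fun n => `|u n|)).

Lemma cseq_norm_ub (u : cseq) n : `|u n| <= cseq_norm u.
Proof.
have /cvg_seq_bounded[M [_ uM]] := @cseq_cvg u.
apply: (@sup_ge _ _ (M + 1)); last by exists n.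
by move=> _ [m _ <-]; apply: uM => //; rewrite ltrDl.
Qed.

Lemma cseq_norm_le (u : cseq) M : (forall n, `|u n| <= M) -> cseq_norm u <= M.
Proof.
by move=> uM; apply: sup_le => [|_ [n _ <-]//]; exists `|u 0%N|, 0%N.
Qed.

Lemma cseq_norm_ge0 (u : cseq) : 0 <= cseq_norm u.
Proof. exact: le_trans (cseq_norm_ub u 0%N). Qed.

Lemma cseq_normD (u v : cseq) : cseq_norm (u + v) <= cseq_norm u + cseq_norm v.
Proof.
apply: cseq_norm_le => n; rewrite (le_trans (ler_normD _ _))//.
by rewrite lerD// cseq_norm_ub.
Qed.

Lemma cseq_normZ (l : R) (u : cseq) : cseq_norm (l *: u) = `|l| * cseq_norm u.
Proof.
apply: sup_homogeneous => [|k v]; first exact: cseq_norm_ge0.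
by apply: cseq_norm_le => n; rewrite normrM ler_wpM2l// cseq_norm_ub.
Qed.

Lemma cseq_norm0_eq0 (u : cseq) : cseq_norm u = 0 -> u = 0.
Proof.
move=> u0; apply: cseqP => n; rewrite [RHS]/=.
by apply/eqP; rewrite -normr_le0 -u0 cseq_norm_ub.
Qed.

HB.instance Definition _ :=
  Lmodule_isNormed.Build R cseq cseq_normD cseq_normZ cseq_norm0_eq0.

End ConvergentSequences.

(* Main.v *)
Require Import Defs.
From HB Require Import structures.
From mathcomp Require Import all_boot all_order all_algebra.
From mathcomp Require Import all_classical all_reals all_analysis.
From mathcomp Require Import lra.
Import Order.TTheory GRing.Theory Num.Theory.
Import numFieldNormedType.Exports.
Local Open Scope classical_set_scope.
Local Open Scope ring_scope.

Set Implicit Arguments.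
Unset Strict Implicit.
Unset Printing Implicit Defensive.

(* Let e_i be the functional corresponding to the i-th unit vector of l_1, so
   that X embeds in l_infty by x |-> (e_i x)_i and the extreme points of the
   dual ball are the +-e_i.

   The main tool is an extension theorem: a bounded sequence b (an element of
   the bidual) whose pairing is constant on two weak* compact sets of
   functionals can be replaced there by an element x of X, with control of every
   |e_i x|. Helly's theorem gives elements of X that agree with b on finitely
   many coordinates; they converge to b only pointwise on the dual ball, and
   Simons' lemma produces an element of their convex sets for which the
   inequalities hold up to epsilon, uniformly. Iterating removes epsilon.

   From the face to c: by (iii) v_n is weak* isolated in the closure of the
   extreme points of D(xbar), so one can successively split off xbar elements
   x_n with v_k(x_n) = [k = n] and
   |e_i (xbar - x_0 - ... - x_n)| + |e_i x_0| + ... + |e_i x_n| <= 1 for all i;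
   then u |-> lim u * xbar + sum_n (u_n - lim u) * x_n is an isometry.

   From c to the face: if T embeds c, let u_N be the image of the indicator of
   [N, oo[, and let v_n be an extreme point of the dual ball norming the image of
   the n-th unit vector, so that v_n(u_N) = [N <= n]. The set F made of the v_n
   and of the face W = {f | f(u_N) = 1 for all N} is weak* closed, and averaging
   extensions that vanish at one e_k outside +-F gives xbar whose extreme norming
   functionals all lie in F. Their cluster points lie in W, whose elements are
   supported off the v_n. *)

(** * Sublinear functionals and the Hahn-Banach theorem *)

Section HahnBanach.
Context {R : realType} {V : lmodType R}.
Implicit Types (p q : V -> R) (x y a : V).

(** Homogeneity is asked only as an inequality for positive scalars, which is easier to check for
    infima; [sublinearZ] recovers equality through the inverse scalar. *)
Definition sublinear p :=
  [/\ p 0 = 0, forall x y, p (x + y) <= p x + p y &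
      forall t x, 0 < t -> p (t *: x) <= t * p x].

Lemma sublinearZ p t x : sublinear p -> 0 <= t -> p (t *: x) = t * p x.
Proof.
move=> [p0 _ pZ]; rewrite le_eqVlt => /orP[/eqP <-|t0].
  by rewrite scale0r mul0r.
apply/eqP; rewrite eq_le pZ//= -ler_pdivlMl//.
rewrite -[X in p X <= _](scale1r x) -(mulVf (lt0r_neq0 t0)) -scalerA.
by rewrite pZ ?invr_gt0.
Qed.

Lemma sublinear_ge p x : sublinear p -> - p (- x) <= p x.
Proof.
move=> [p0 pD _]; rewrite -subr_ge0 opprK.
by apply: le_trans (pD _ _); rewrite subrr p0.
Qed.

(* Since [shift_inf p a] is sublinear, below [p] and at most [- p a] at [- a], a
   minimal sublinear functional is odd, hence linear. *)
Definition shift_inf p a x : R :=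
  inf [set p (x + t *: a) - t * p a | t in [set t | 0 <= t]].

Lemma shift_inf_lb p a x : sublinear p ->
  lbound [set p (x + t *: a) - t * p a | t in [set t | 0 <= t]] (- p (- x)).
Proof.
move=> sp _ [t /= t0 <-]; rewrite -sublinearZ//.
case: sp => _ pD _; have := pD (x + t *: a) (- x).
rewrite addrAC subrr add0r; lra.
Qed.

Lemma shift_inf_le p a x t : sublinear p -> 0 <= t ->
  shift_inf p a x <= p (x + t *: a) - t * p a.
Proof.
move=> sp t0; apply: ge_inf; last by exists t.
by exists (- p (- x)); exact: shift_inf_lb.
Qed.

Lemma shift_inf_ge p a x r :
  (forall t, 0 <= t -> r <= p (x + t *: a) - t * p a) -> r <= shift_inf p a x.
Proof.
move=> h; apply: lb_le_inf; first by exists (p (x + 0 *: a) - 0 * p a), 0 => /=.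
by move=> _ [t /= t0 <-]; exact: h.
Qed.

(** Parameters [t] and [s] for two summands combine to [t + s] for their sum; scaling the vector
    scales the parameter. *)
Lemma shift_inf_sublinear p a : sublinear p -> sublinear (shift_inf p a).
Proof.
move=> sp; have [p0 pD pZ] := sp; split.
- apply/eqP; rewrite eq_le; apply/andP; split.
    by have := @shift_inf_le p a 0 0 sp (lexx _); rewrite scale0r addr0 p0 mul0r subr0.
  by apply: shift_inf_ge => t t0; rewrite add0r sublinearZ// subrr.
- move=> x y; rewrite -lerBlDr; apply: shift_inf_ge => t t0.
  rewrite lerBlDr -lerBlDl; apply: shift_inf_ge => s s0.
  have := @shift_inf_le p a (x + y) (t + s) sp (addr_ge0 t0 s0).
  have := pD (x + t *: a) (y + s *: a).
  rewrite addrACA -scalerDl mulrDl; lra.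
- move=> t x t0; rewrite -ler_pdivrMl//; apply: shift_inf_ge => s s0.
  rewrite ler_pdivrMl//.
  apply: le_trans (shift_inf_le a _ sp (mulr_ge0 (ltW t0) s0)) _.
  by rewrite -scalerA -scalerDr sublinearZ ?(ltW t0)// mulrBr mulrA.
Qed.

Lemma shift_inf_id p a x : sublinear p -> shift_inf p a x <= p x.
Proof.
move=> sp; have := @shift_inf_le p a x 0 sp (lexx _).
by rewrite scale0r addr0 mul0r subr0.
Qed.

Lemma shift_infN p a : sublinear p -> shift_inf p a (- a) <= - p a.
Proof.
move=> sp; have [p0 _ _] := sp; have := @shift_inf_le p a (- a) 1 sp ler01.
by rewrite scale1r addNr p0 mul1r sub0r.
Qed.

(** Zorn's lemma for the reversed pointwise order: a chain is bounded by its pointwise infimum,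
    finite because [- p (- x) <= q x] for every sublinear [q] below [p]. *)
Lemma sublinear_minimal p : sublinear p ->
  exists q, [/\ sublinear q, forall x, q x <= p x &
    forall r, sublinear r -> (forall x, r x <= q x) -> r = q].
Proof.
move=> sp; pose T := {q : V -> R | sublinear q /\ forall x, q x <= p x}.
have lbT (q : T) x : - p (- x) <= sval q x.
  case: q => q [sq qp] /=; apply: le_trans (sublinear_ge x sq).
  by rewrite lerN2.
pose le' (q r : T) := `[< forall x, sval r x <= sval q x >].
have [| | | |[q [sq qp]] qmin] := @Zorn T le'.
- by move=> q; apply/asboolP.
- move=> q r s /asboolP qr /asboolP rs; apply/asboolP => x.
  exact: le_trans (rs x) (qr x).
- move=> [q hq] [r hr] /asboolP /= qr /asboolP /= rq; apply: eq_exist.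
  by apply/funext => x; apply/eqP; rewrite eq_le qr rq.
- move=> A totA.
  have [A0|/set0P[q0 Aq0]] := eqVneq A set0.
    by exists (exist _ p (conj sp (fun x => lexx _))) => s; rewrite A0.
  pose E x := [set sval q x | q in A].
  have Elb x : has_lbound (E x) by exists (- p (- x)) => _ [q Aq <-]; exact: lbT.
  have E0 x : E x !=set0 by exists (sval q0 x), q0.
  have Ele (q : T) x : A q -> inf (E x) <= sval q x.
    by move=> Aq; apply: ge_inf => //; exists q.
  have sE : sublinear (fun x => inf (E x)).
    split.
    - rewrite (_ : E 0 = [set 0]) ?inf1//; apply/seteqP; split=> r.
        by move=> [[q [[q00 ? ?] ?]] ? /= <-].
      by move=> ->; exists q0 => //; case: q0 {Aq0 E0} => q [[]].
    - move=> x y; rewrite -lerBlDr; apply: lb_le_inf => // _ [q Aq <-].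
      rewrite lerBlDr -lerBlDl; apply: lb_le_inf => // _ [r Ar <-].
      rewrite lerBlDl.
      (* In a chain, the smaller of [q] and [r] serves in both estimates. *)
      have [s [As sq sr]] : exists s, [/\ A s, forall x, sval s x <= sval q x &
          forall x, sval s x <= sval r x].
        by have [/asboolP h|/asboolP h] := totA _ _ Aq Ar; [exists r|exists q].
      apply: le_trans (Ele s _ As) _.
      case: s {As} sq sr => s [[? sD ?] ?] /= sq sr.
      by apply: le_trans (sD _ _) _; rewrite lerD.
    - move=> t x t0; rewrite -ler_pdivrMl//; apply: lb_le_inf => // _ [q Aq <-].
      rewrite ler_pdivrMl//; apply: le_trans (Ele q _ Aq) _.
      by case: q {Aq} => q [[? ? qZ] ?]; exact: qZ.
  have Ep x : inf (E x) <= p x.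
    apply: le_trans (Ele q0 _ Aq0) _.
    by case: q0 {Aq0 E0} => q [? /=].
  by exists (exist _ (fun x => inf (E x)) (conj sE Ep)) => q Aq; apply/asboolP => x /=; exact: Ele.
exists q; split=> // r sr rq.
have rp x : r x <= p x by exact: le_trans (rq x) (qp x).
have /qmin[//] : le' (exist _ q (conj sq qp)) (exist _ r (conj sr rp)).
exact/asboolP.
Qed.

(** Minimality is taken below [shift_inf p a] rather than [p]: its bound [- p a] at [- a] forces the
    value [p a] at [a]. *)
Theorem hahn_banach p a : sublinear p ->
  exists f : V -> R^o, [/\ linear f, forall x, f x <= p x & f a = p a].
Proof.
move=> sp; have [q [sq qp qmin]] := @sublinear_minimal _ (shift_inf_sublinear a sp).
have qN x : q (- x) = - q x.
  have e := qmin _ (shift_inf_sublinear x sq) (fun y => shift_inf_id x y sq).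
  apply/eqP; rewrite eq_le -{1}e shift_infN//=.
  by have := sublinear_ge (- x) sq; rewrite opprK.
have [q0 qD qZ] := sq.
have qDe x y : q (x + y) = q x + q y.
  apply/eqP; rewrite eq_le qD/= -lerN2 -!qN opprD.
  by rewrite (le_trans (qD _ _))// !qN opprD.
exists q; split.
- move=> t x y; rewrite qDe; congr (_ + _).
  have [t0|t0] := leP 0 t; first exact: sublinearZ.
  by rewrite -[LHS]opprK -qN -scaleNr sublinearZ ?oppr_ge0 ?(ltW t0)// mulNr opprK.
- by move=> x; exact: le_trans (qp x) (shift_inf_id _ _ sp).
- apply/eqP; rewrite eq_le (le_trans (qp a) (shift_inf_id _ _ sp))/=.
  by rewrite -lerN2 -qN (le_trans (qp _))// shift_infN.
Qed.

End HahnBanach.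

(** * Simons' lemma *)

Lemma cvg0_le_norm (R : realType) (V : normedModType R) (u : nat -> V) (r : nat -> R) :
  (forall n, `|u n| <= r n) -> r @ \oo --> (0 : R) -> u @ \oo --> (0 : V).
Proof.
move=> ur r0; apply/cvgr0Pnorm_lt => e e0; near=> n.
apply: le_lt_trans (ur n) _; apply: le_lt_trans (ler_norm _) _.
by near: n; move/cvgr0Pnorm_lt : r0; apply.
Unshelve. all: by end_near. Qed.

Lemma geometric_step_cvg (R : realType) (V : completeNormedModType R)
    (u : nat -> V) (K : R) :
  (forall n, `|u n.+1 - u n| <= K * 2^-1 ^+ n) -> cvgn u.
Proof.
move=> uK; rewrite (_ : u = cst (u 0%N) + series (telescope u)); last first.
  by apply/funext => n; rewrite {1}eq_sum_telescope.
apply: is_cvgD; first exact: is_cvg_cst.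
apply: normed_cvg; apply: (@series_le_cvg _ _ (geometric K 2^-1)) => [n|n|n|] //=.
- exact: le_trans (uK n).
- exact: uK.
- by apply: is_cvg_geometric_series; rewrite ger0_norm ?invr_ge0// invf_lt1 ?ltr1n.
Qed.

Section Simons.
Context {R : realType} {X : completeNormedModType R}.
(** A pair [p] in [C] stands for the affine function [x |-> p.1 x + p.2]. Convexity of [D n] is
    stated for midpoints, as all weights below are built from powers of 1/2. *)
Variables (C : set (dual X * R)) (D : nat -> set X) (M : R).

Hypothesis C_max : forall x, exists2 p, C p &
  forall q, C q -> q.1 x + q.2 <= p.1 x + p.2.
Hypothesis D_neq0 : forall n, D n !=set0.
Hypothesis D_closed : forall n, closed (D n).
Hypothesis D_mid : forall n x y, D n x -> D n y -> D n (2^-1 *: (x + y)).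
Hypothesis D_decr : forall n, D n.+1 `<=` D n.
Hypothesis D_bounded : forall x, D 0%N x -> `|x| <= M.
Hypothesis D_small : forall p, C p -> forall d : R, 0 < d ->
  exists n, forall x, D n x -> p.1 x + p.2 <= d.

Let h : R := 2^-1.

(** How far along [D n] a function becomes small depends on the function; the construction finds one
    point at which the maximizing function itself is small. *)
Theorem simons (e : R) : 0 < e ->
  exists2 x, D 0%N x & forall p, C p -> p.1 x + p.2 <= e.
Proof.
move=> e0.
have h0 : 0 < h by rewrite invr_gt0.
have hn0 n : h ^+ n != 0 by rewrite expf_neq0// lt0r_neq0.
have /choice[g gP] : forall x, exists p, C p /\
    forall q, C q -> q.1 x + q.2 <= p.1 x + p.2.
  by move=> x; have [p Cp pmax] := C_max x; exists p.
(* Each [y n] almost minimizes [S] on [z n + h ^+ n *: D n], and the limit [zl] of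
   [z] is [z n + h ^+ n *: w n] with [w n] in [D n]; hence the functional [p] that
   attains the maximum at [zl] hardly decreases along [w], whereas [D_small] makes
   it small there. *)
pose S x := Num.max ((g x).1 x + (g x).2) 0.
(* One factor [h ^+ n] cancels against the scale of [D n]; the remaining errors [e / 4 * h ^+ n] sum
   to [e / 2]. *)
pose ep n : R := e / 4%:R * h ^+ n * h ^+ n.
have ep0 n : 0 < ep n by rewrite !mulr_gt0// ?exprn_gt0// invr_gt0.
have /choice[pick pickP] : forall nz : nat * X, exists y, D nz.1 y /\
    forall y', D nz.1 y' -> S (nz.2 + h ^+ nz.1 *: y) <= S (nz.2 + h ^+ nz.1 *: y') + ep nz.1.
  move=> [n z] /=.
  (* The truncation at 0 bounds [S] from below. *)
  have hinf : has_inf [set S (z + h ^+ n *: y) | y in D n].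
    split; first by have [y Dy] := D_neq0 n; exists (S (z + h ^+ n *: y)), y.
    by exists 0 => _ [y _ <-]; rewrite /S le_max lexx orbT.
  have [_ [y Dy <-] lty] := inf_adherent (ep0 n) hinf.
  exists y; split=> // y' Dy'; apply: le_trans (ltW lty) _.
  by rewrite lerD2r; apply: ge_inf; [exact: hinf.2|exists y'].
(* The candidate is tested at scale [h ^+ m], but the step taken has scale [h ^+ m.+1]: half of the
   weight remains for later steps. *)
pose z := fix z n : X := if n is m.+1 then z m + h ^+ m.+1 *: pick (m, z m) else 0.
pose y n := pick (n, z n).
have zS n : z n.+1 = z n + h ^+ n.+1 *: y n by [].
have Dy n : D n (y n) by have [] := pickP (n, z n).
have ymin n y' : D n y' -> S (z n + h ^+ n *: y n) <= S (z n + h ^+ n *: y') + ep n.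
  by have [_] := pickP (n, z n); exact.
have DD n k : D (n + k)%N `<=` D n.
  elim: k => [|k IH]; first by rewrite addn0.
  by rewrite addnS => x /D_decr/IH.
have yM n : `|y n| <= M by apply: D_bounded; apply: (DD 0%N n); exact: Dy.
have zcvg : cvgn z.
  apply: (@geometric_step_cvg _ _ _ (h * M)) => n.
  rewrite -/h zS addrC addKr normrZ ger0_norm ?(exprn_ge0 _ (ltW h0))//.
  have := ler_wpM2l (mulr_ge0 (ltW h0) (exprn_ge0 n (ltW h0))) (yM n).
  by rewrite exprSr; lra.
pose zl := limn z.
(* The rescaled difference carries the weights [h, ..., h ^+ k] and [x] the missing weight [h ^+ k];
   repeated midpoints produce this convex combination. *)
have Dcomb n k x : D (n + k)%N x ->
    D n ((h ^+ n)^-1 *: (z (n + k)%N - z n) + h ^+ k *: x).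
  elim: k x => [|k IH] x.
    by rewrite addn0 subrr scaler0 add0r expr0 scale1r.
  rewrite addnS => Dx.
  have := IH _ (D_mid (Dy (n + k)%N) (D_decr Dx)).
  congr (D n _).
  rewrite zS addrAC [X in _ = X + _]scalerDr -[RHS]addrA; congr (_ + _).
  rewrite !scalerA scalerDr; congr (_ *: _ + _ *: _).
    by rewrite -addnS exprD mulKf// exprSr.
  by rewrite exprSr.
pose w n := (h ^+ n)^-1 *: (zl - z n).
have Dw n : D n (w n).
  apply: (@closed_cvg _ _ \oo _
    (fun k => (h ^+ n)^-1 *: (z (n + k)%N - z n) + h ^+ k *: y (n + k)%N)).
  - exact: D_closed.
  - by near=> k; exact/Dcomb/Dy.
  - rewrite -[w n]addr0; apply: cvgD.
      apply: cvgZr; apply: cvgB; last exact: cvg_cst.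
      have := zcvg; rewrite -(cvg_shiftn n).
      by under eq_fun do rewrite addnC.
    apply: (@cvg0_le_norm _ _ _ (geometric M h)).
      move=> k; rewrite normrZ ger0_norm ?(exprn_ge0 _ (ltW h0))// mulrC.
      by rewrite ler_wpM2r ?(exprn_ge0 _ (ltW h0)).
    by apply: cvg_geometric; rewrite ger0_norm ?ltW// invf_lt1 ?ltr1n.
have zlE n : zl = z n + h ^+ n *: w n.
  by rewrite /w scalerA mulfV// scale1r addrC subrK.
have wS n : w n.+1 = 2%:R *: w n - y n.
  rewrite /w zS opprD addrA scalerBr (scalerA (h ^+ n.+1)^-1) mulVf ?hn0// scale1r.
  by congr (_ - _); rewrite scalerA exprSr invfM invrK mulrC.
have w0 : w 0%N = zl by rewrite /w expr0 invr1 scale1r subr0.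
exists zl; first by rewrite -w0; exact: Dw.
have [Cp pmax] := gP zl; set p := g zl in Cp pmax.
move=> q Cq; apply: le_trans (pmax q Cq) _.
rewrite leNgt; apply/negP => lep.
have SE : S zl = p.1 zl + p.2.
  by rewrite /S max_l// ltW// (lt_trans e0).
(* Since [w n.+1] is [2 w n - y n], near-minimality of [y n] against [w n] costs at most
   [e / 4 * h ^+ n] per step. *)
have pw n : p.1 zl - e / 2%:R * (1 - h ^+ n) <= p.1 (w n).
  elim: n => [|n IH]; first by rewrite expr0 subrr mulr0 subr0 w0.
  have := ymin n _ (Dw n); rewrite -zlE SE => le1.
  have le2 : p.1 (z n + h ^+ n *: y n) + p.2 <= S (z n + h ^+ n *: y n).
    by rewrite /S le_max; apply/orP; left; have [_] := gP (z n + h ^+ n *: y n); exact.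
  have fE x c v : p.1 (x + c *: v) = p.1 x + c * p.1 v by rewrite linearD linearZ.
  have := le_trans le2 le1; rewrite {1}(zlE n) !fE /ep => le3.
  have -> : p.1 (w n.+1) = 2%:R * p.1 (w n) - p.1 (y n).
    by rewrite wS linearB linearZ.
  have le4 : p.1 (y n) <= p.1 (w n) + e / 4%:R * h ^+ n.
    rewrite -(ler_pM2l (exprn_gt0 n h0)) mulrDr; lra.
  rewrite exprS.
  rewrite (_ : h = 2^-1)//; set t := _ ^+ n in IH le4 *; lra.
(* By [pw], [p] stays above [e / 2] along [w], against the bound [e / 4] here. *)
have [n Dn] := D_small Cp (divr_gt0 e0 (ltr0n _ 4)).
have := Dn _ (Dw n); have := pw n.
have : 0 < e / 2%:R * h ^+ n by rewrite mulr_gt0 ?divr_gt0// exprn_gt0.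
lra.
Unshelve. all: by end_near.
Qed.

End Simons.

(** * The weak-star topology *)

Section WeakStar.
Context {R : realType} {X : normedModType R}.
Implicit Types (f : dual X) (x : X).

Lemma weak_star_cvgP (F : set_system (weak_star X)) (f : weak_star X) :
  Filter F -> F --> f <-> forall x, (fun g : weak_star X => (g : dual X) x) @ F --> (f : dual X) x.
Proof.
move=> FF; pose emb (g : weak_star X) : {ptws X -> R^o} := (g : dual X).
split=> [Ff x|Ff A].
  have Fe : {ptws, emb @ F --> emb f}.
    by apply: cvg_comp Ff _; exact: (@initial_continuous (dual X) {ptws X -> R^o} emb).
  by move/pointwise_cvgP : Fe; exact.
move=> [_ [[B oB <-] Bf sBA]].
apply: (filterS sBA).
have : {ptws, (fun g : weak_star X => (g : dual X) : X -> R^o) @ F --> (f : X -> R^o)}.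
  by apply/pointwise_cvgP => x; exact: Ff.
have fB : nbhs (f : {ptws X -> R^o}) B by exact: (open_nbhs_nbhs (conj oB Bf)).
by move=> /(_ B fB).
Qed.

Lemma weak_star_eval_continuous x :
  continuous (fun g : weak_star X => (g : dual X) x : R^o).
Proof.
move=> f; have /weak_star_cvgP/(_ x) : nbhs f --> (f : weak_star X) by exact: cvg_id.
exact.
Qed.

Lemma weak_star_hausdorff : hausdorff_space (weak_star X).
Proof.
move=> f g fg; apply: dualP => x; apply: (@norm_hausdorff _ R^o).
move=> A B Afx Bgx.
have [k [? ?]] := fg _ _ (@weak_star_eval_continuous x f _ Afx)
  (@weak_star_eval_continuous x g _ Bgx).
by exists ((k : dual X) x).
Qed.

Lemma dual_scale f (c : R) x : f (c *: x) = c * f x.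
Proof. by rewrite linearZ. Qed.

Lemma dual_add f x y : f (x + y) = f x + f y.
Proof. by rewrite linearD. Qed.

Lemma dual_sub f x y : f (x - y) = f x - f y.
Proof. by rewrite linearB. Qed.

Lemma dual_sum (I : Type) (r : seq I) (F : I -> X) f :
  f (\sum_(i <- r) F i) = \sum_(i <- r) f (F i).
Proof. by rewrite linear_sum. Qed.

Lemma dual_norm_bound f x : `|f x| <= `|f| * `|x|.
Proof.
have [->|x0] := eqVneq x 0; first by rewrite linear0 !normr0 mulr0.
have nx : 0 < `|x| by rewrite normr_gt0.
have := @dual_norm_ub _ _ f (`|x|^-1 *: x).
rewrite normrZ normfV normr_id mulVf ?gt_eqF// lexx => /(_ isT).
by rewrite linearZ/= normrM normfV normr_id ler_pdivrMl// mulrC.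
Qed.

Lemma dual_norm_le_bound f M : 0 <= M -> (forall x, `|f x| <= M * `|x|) -> `|f| <= M.
Proof.
move=> M0 fM; apply: dual_norm_le => x x1; apply: le_trans (fM x) _.
by rewrite ler_piMr.
Qed.

Lemma dual_of_bounded (l : X -> R^o) M :
  linear l -> (forall x, `|l x| <= M * `|x|) -> exists f : dual X, forall x, f x = l x.
Proof.
move=> lin lM; pose L := GRing.isLinear.Build R X R^o _ l lin.
pose l' : {linear X -> R^o} := HB.pack l L.
have lc : continuous (l : X -> R^o).
  apply: (@bounded_linear_continuous _ _ _ l').
  apply/linear_boundedP; near=> r => x; apply: le_trans (lM x) _.
  by rewrite ler_wpM2r//; near: r; apply: nbhs_pinfty_ge; rewrite num_real.
have lD : (l : X -> R^o) \in @continuous_functional R X by apply/continuous_functionalP.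
by exists (Dual lD).
Unshelve. all: by end_near. Qed.

(** Banach-Alaoglu by ultrafilters: each evaluation stays in a compact segment, hence converges
    along [F]; the pointwise limit is linear and bounded by the norm. *)
Lemma weak_star_ball_compact : compact (unit_ball (dual X) : set (weak_star X)).
Proof.
rewrite compact_ultra => F UF FB; have PF : ProperFilter F by exact: ultra_proper.
pose ev x := fun g : weak_star X => (g : dual X) x : R^o.
have FBx x : F [set g | `|ev x g| <= `|x|].
  apply: filterS FB => g /= g1; apply: le_trans (dual_norm_bound _ _) _.
  by rewrite ler_piMl.
have /choice[l lP] : forall x, exists l : R^o, ev x @ F --> l /\ `|l| <= `|x|.
  move=> x; have [|l [/= ll Fl]] := @segment_compact R (- `|x|) `|x| (ev x @ F) _.
    change (F (ev x @^-1` `[- `|x|, `|x|]%classic)).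
    by apply: filterS (FBx x) => g /=; rewrite in_itv/= -ler_norml.
  exists l; split; last by rewrite ler_norml; rewrite in_itv/= in ll.
  move=> A lA; have [//|FA] := in_ultra_setVsetC (ev x @^-1` A) UF.
  by have [r [/= rA rB]] := Fl (~` A) A FA lA.
have lcvg x : ev x @ F --> l x by have [] := lP x.
have lin : linear (l : X -> R^o).
  move=> a x y; apply: (@cvg_unique _ (@norm_hausdorff _ R^o) (ev (a *: x + y) @ F) _ _ _ (lcvg _)).
  have -> : ev (a *: x + y) = (fun g => a *: ev x g) \+ ev y.
    by apply/funext => g; rewrite /ev linearP.
  by apply: cvgD; [apply: cvgZl_tmp|]; exact: lcvg.
have [|f fE] := @dual_of_bounded l 1 lin.
  by move=> x; rewrite mul1r; have [] := lP x.
exists (f : weak_star X); split; last by apply/weak_star_cvgP => x; rewrite fE; exact: lcvg.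
apply: dual_norm_le => x x1; rewrite fE; apply: le_trans x1.
by have [] := lP x.
Qed.

Lemma weak_star_ball_closed : closed (unit_ball (dual X) : set (weak_star X)).
Proof.
by apply: compact_closed; [exact: weak_star_hausdorff|exact: weak_star_ball_compact].
Qed.

Lemma weak_star_closure_norming (B : set (dual X)) x f :
  (forall g, B g -> `|g| <= 1 /\ g x = 1) -> closure (B : set (weak_star X)) f ->
  `|f| <= 1 /\ f x = 1.
Proof.
move=> Bx Bf; split.
  by apply: weak_star_ball_closed; apply: closureS Bf => g /Bx[].
have : closed [set g : weak_star X | (g : dual X) x = 1].
  apply: (@preimage_closed (weak_star X) R^o (fun g => (g : dual X) x) [set r | r = 1]).
    by move=> g _; exact: weak_star_eval_continuous.
  exact: (@closed_eq R).
by apply; apply: closureS Bf => g /Bx[].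
Qed.

End WeakStar.

(** * Weak-star convergence tested on a total sequence *)

Section WeakStarSequences.
Context {R : realType} {X : normedModType R}.
Variable z : nat -> X.
Hypothesis z_total : forall f : dual X, (forall j, f (z j) = 0) -> f = 0.
Variable v : nat -> dual X.
Hypothesis v_ball : forall n, `|v n| <= 1.

(** Otherwise the indices outside a neighbourhood [U] of [f] yield a cluster point in the compact
    ball; it agrees with [f] on every [z j], hence equals [f], although [U] is avoided. *)
Lemma weak_star_cvg_total (f : dual X) :
  (forall j, (fun n => v n (z j)) @ \oo --> f (z j)) -> weak_star_cvg v f.
Proof.
move=> vf U Uf; apply: contrapT => nU.
have DP N : exists2 n, (N <= n)%N & ~ U (v n).
  apply: contrapT => hN; apply: nU; exists N => // n /= Nn.
  by apply: contrapT => nUn; apply: hN; exists n.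
pose F : set_system nat := within [set n | ~ U (v n)] \oo.
have PF : ProperFilter F.
  apply: Build_ProperFilter_ex => A [N _ NA].
  by have [n Nn nUn] := DP N; exists n; exact: NA.
have [|g [_ clg]] := @weak_star_ball_compact R X ((v : nat -> weak_star X) @ F) _.
  by exists 0%N => // n _ _; exact: v_ball.
suff gf : g = f.
  have FU : ((v : nat -> weak_star X) @ F) (~` U) by exists 0%N => // n _ /=.
  have Ug : nbhs (g : weak_star X) U by rewrite gf.
  by have [h [/= nUh Uh]] := clg _ _ FU Ug.
apply/eqP; rewrite -subr_eq0; apply/eqP; apply: z_total => j.
apply/eqP; rewrite [_ == 0]subr_eq0; apply/eqP/esym.
apply: (@Rhausdorff R) => A B fA gB.
have FA : ((v : nat -> weak_star X) @ F) [set h | A ((h : dual X) (z j))].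
  by have [N _ NA] := vf j _ fA; exists N => // n Nn _; exact: NA.
have nB : nbhs (g : weak_star X) [set h | B ((h : dual X) (z j))].
  exact: (@weak_star_eval_continuous _ _ (z j) g _ gB).
by have [h [/= hA hB]] := clg _ _ FA nB; exists ((h : dual X) (z j)).
Qed.

End WeakStarSequences.

(** Indices are picked increasingly around a cluster point in the compact ball, the one of stage [n]
    within [1 / (n + 1)] on [z 0, ..., z n]. *)
Lemma weak_star_subsequence (R : realType) (X : normedModType R)
    (z : nat -> X) (v : nat -> dual X) :
  (forall f : dual X, (forall j, f (z j) = 0) -> f = 0) ->
  (forall n, `|v n| <= 1) ->
  exists s f, (forall n, (s n < s n.+1)%N) /\ weak_star_cvg (v \o s) f.
Proof.
move=> z_total v_ball.
have [|f [_ clf]] := @weak_star_ball_compact R X ((v : nat -> weak_star X) @ \oo) _.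
  by exists 0%N => // n _; exact: v_ball.
have /choice[next nextP] : forall Nn : nat * nat, exists p, (Nn.1 < p)%N /\
    forall j, (j <= Nn.2)%N -> `|v p (z j) - f (z j)| <= Nn.2.+1%:R^-1.
  move=> [N n] /=.
  have FN : ((v : nat -> weak_star X) @ \oo) [set v p | p in [set p | (N < p)%N]].
    by exists N.+1 => // p Np; exists p.
  have nbn : nbhs (f : weak_star X) [set g : weak_star X | forall j, (j <= n)%N ->
      `|(g : dual X) (z j) - f (z j)| <= n.+1%:R^-1].
    have n0 : 0 < n.+1%:R^-1 :> R by rewrite invr_gt0.
    have : \forall g \near (f : weak_star X), forall j : 'I_n.+1,
        `|(g : dual X) (z j) - f (z j)| <= n.+1%:R^-1.
      have FF : Filter (nbhs (f : weak_star X)) by exact: nbhs_filter.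
      apply: (@filter_forall _ _ _ _ FF) => j.
      have /cvgrPdistC_le := @weak_star_eval_continuous _ _ (z j) f; exact.
    by apply: filterS => g gP j jn; exact: (gP (Ordinal (jn : (j < n.+1)%N))).
  have [_ [[p Np <-] pz]] := clf _ _ FN nbn.
  by exists p.
pose s := fix s n := if n is m.+1 then next (s m, n) else next (0%N, 0%N).
exists s, f; split; first by move=> n; have [] := nextP (s n, n.+1).
apply: (weak_star_cvg_total z_total) => [n|j]; first exact: v_ball.
have sP n : forall j, (j <= n)%N -> `|v (s n) (z j) - f (z j)| <= n.+1%:R^-1.
  by case: n => [|n]; [have [] := nextP (0%N, 0%N)|have [] := nextP (s n, n.+1)].
apply/subr_cvg0; apply/cvgr0Pnorm_le => eps eps0.
near=> n; apply: (le_trans (sP n j _)).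
  by near: n; exact: nbhs_infty_ge.
near: n; have /cvgr0Pnorm_le/(_ _ eps0) := @cvg_harmonic R.
by apply: filterS => n /=; rewrite ger0_norm.
Unshelve. all: by end_near. Qed.

(** * Isometric copies of [c] *)

Section CopyOfC.
Context {R : realType} {X : completeNormedModType R}.
Variable e : nat -> dual X.
Hypothesis norm_le_e : forall (z : X) (M : R), (forall i, `|e i z| <= M) -> `|z| <= M.
Variables (xbar : X) (v : nat -> dual X) (x : nat -> X).
Hypothesis v_ball : forall k, `|v k| <= 1.
Hypothesis v_xbar : forall k, v k xbar = 1.
Hypothesis v_x : forall k j, v k (x j) = (k == j)%:R.
Hypothesis x_split : forall n i,
  `|e i (xbar - \sum_(j < n) x j)| + \sum_(j < n) `|e i (x j)| <= 1.

Let term (u : cseq R) j : X := ((u j : R) - limn (u : nat -> R^o)) *: x j.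
Let approx (u : cseq R) n : X := limn (u : nat -> R^o) *: xbar + series (term u) n.

(** In this grouping all coefficients are at most [|u|] in absolute value, so [x_split] applies. *)
Lemma approxE (u : cseq R) n : approx u n =
  limn (u : nat -> R^o) *: (xbar - \sum_(j < n) x j) + \sum_(j < n) (u j : R) *: x j.
Proof.
rewrite /approx /series/= big_mkord scalerBr scaler_sumr -addrA; congr (_ + _).
rewrite addrC -sumrB; apply: eq_bigr => j _.
by rewrite /term scalerBl.
Qed.

Lemma sum_e_x i n p : \sum_(n <= j < p) `|e i (x j)| <= 1.
Proof.
have [pn|np] := leqP p n; first by rewrite big_geq.
apply: le_trans (x_split p i).
rewrite -(big_mkord xpredT (fun j => `|e i (x j)|)) (@big_cat_nat _ _ _ n 0 p) ?(ltnW np)//=.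
by rewrite addrA lerDr addr_ge0 ?sumr_ge0.
Qed.

Lemma cseq_lim_norm (u : cseq R) : `|limn (u : nat -> R^o)| <= `|u|.
Proof.
have uc := @cseq_cvg _ u.
have : (fun n => `|u n|) @ \oo --> `|limn (u : nat -> R^o)| by apply: cvg_norm.
move=> h; apply: (cvgr_to_le h); near=> n; exact: cseq_norm_ub.
Unshelve. all: by end_near. Qed.

(** Late coefficients are at most [eps / 2], while [sum_e_x] bounds the sums of [|e i (x j)|] by 1
    for all [i] at once. *)
Lemma approx_cvg u : cvgn (approx u).
Proof.
apply: is_cvgD; first exact: is_cvg_cst.
apply/cauchy_cvgP/cauchy_seriesP => eps eps0.
have e20 : 0 < eps / 2%:R by rewrite divr_gt0.
have /cvgrPdist_le/(_ _ e20)[N _ uN] := @cseq_cvg _ u.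
exists ([set n | (N <= n)%N], setT) => /=; first by split=> //; exists N.
move=> [n p] [/= Nn _].
apply: (@le_lt_trans _ _ (eps / 2%:R)); last by rewrite ltr_pdivrMr// mulr_natr mulr2n ltrDl.
apply: norm_le_e => i; rewrite dual_sum.
apply: le_trans (ler_norm_sum _ _ _) _.
apply: (@le_trans _ _ (\sum_(n <= j < p) eps / 2%:R * `|e i (x j)|)).
  apply: ler_sum_nat => j /andP[nj _].
  rewrite /term dual_scale normrM ler_wpM2r// distrC.
  by apply: uN => /=; exact: leq_trans nj.
by rewrite -mulr_sumr ler_piMr ?(ltW e20)// sum_e_x.
Qed.

Definition copy_fun (u : cseq R) : X := limn (approx u).

Lemma copy_linear : linear copy_fun.
Proof.
move=> a u w; set g := (X in copy_fun X).
have gE j : (g j : R) = a * u j + w j by [].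
clearbody g.
have limE : limn (g : nat -> R^o) = a * limn (u : nat -> R^o) + limn (w : nat -> R^o).
  rewrite (_ : (g : nat -> R^o) = (fun j => a * u j + w j)); last exact/funext.
  apply: cvg_lim => //; apply: (@cvgD _ R^o); last exact: (@cseq_cvg _ w).
  by apply: (@cvgMl_tmp R); exact: (@cseq_cvg _ u).
apply: cvg_lim => //.
have -> : approx g = (fun n => a *: approx u n + approx w n).
  apply/funext => n; rewrite !approxE limE; move: (xbar - _) => P.
  rewrite scalerDl scalerDr -scalerA scaler_sumr -!addrA; congr (_ + _).
  rewrite addrCA; congr (_ + _); rewrite -big_split/=; apply: eq_bigr => j _.
  by rewrite gE scalerDl -scalerA.
apply: cvgD; last exact: approx_cvg.
by apply: cvgZl_tmp; exact: approx_cvg.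
Qed.

(** The upper bound comes from [approxE] and [x_split], the lower one from [v k], which recovers the
    entry [u k]. *)
Lemma copy_isometric u : `|copy_fun u| = `|u|.
Proof.
apply/eqP; rewrite eq_le; apply/andP; split.
  have : (fun n => `|approx u n|) @ \oo --> `|copy_fun u| by apply: cvg_norm; exact: approx_cvg.
  move=> h; apply: (cvgr_to_le h); near=> n.
  apply: norm_le_e => i; rewrite approxE dual_add dual_scale dual_sum.
  have := cseq_lim_norm u; have : forall j, `|u j : R| <= `|u| by exact: cseq_norm_ub.
  move: (`|u|) (limn _) => N l uN lN.
  have N0 : 0 <= N by exact: le_trans lN.
  apply: le_trans (ler_normD _ _) _.
  apply: (@le_trans _ _ (N * (`|e i (xbar - \sum_(j < n) x j)| + \sum_(j < n) `|e i (x j)|))).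
    rewrite mulrDr; apply: lerD; first by rewrite normrM ler_wpM2r.
    rewrite mulr_sumr; apply: le_trans (ler_norm_sum _ _ _) _; apply: ler_sum => j _.
    by rewrite dual_scale normrM ler_wpM2r.
  by rewrite ler_piMr.
apply: cseq_norm_le => k.
have -> : u k = v k (copy_fun u) :> R.
  apply: (@cvg_unique _ (@Rhausdorff R) ((fun n => v k (approx u n)) @ \oo)).
    apply: cvg_near_cst; near=> n.
    have kn : (k < n)%N by near: n; exact: nbhs_infty_gt.
    have sum_delta (d : nat -> R) : \sum_(j < n) d j * v k (x j) = d k.
      rewrite (bigD1 (Ordinal kn))//= v_x eqxx mulr1 big1 ?addr0// => j.
      by rewrite v_x -val_eqE/= eq_sym => /negbTE ->; rewrite mulr0.
    rewrite approxE dual_add dual_scale dual_sub !dual_sum v_xbar.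
    have := sum_delta (fun=> 1); under eq_bigr do rewrite mul1r; move=> ->.
    rewrite subrr mulr0 add0r; have <- := sum_delta (u : nat -> R^o).
    by apply: eq_bigr => j _; rewrite dual_scale.
  by apply: continuous_cvg; [exact: dual_continuous|exact: approx_cvg].
apply: le_trans (dual_norm_bound _ _) _.
by rewrite ler_piMl.
Unshelve. all: by end_near. Qed.

Lemma copy_of_c : exists T : {linear cseq R -> X}, isometric T.
Proof.
pose L := GRing.isLinear.Build R (cseq R) X _ copy_fun copy_linear.
pose T : {linear cseq R -> X} := HB.pack copy_fun L.
by exists T => u; exact: copy_isometric.
Qed.

End CopyOfC.

(** * Sets of affine functions that attain their supremum at every point *)

Section Attained.
Context {R : realType} {X : normedModType R}.

Definition attained (K : set (dual X * R)) := forall x : X, K !=set0 ->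
  exists2 p, K p & forall q, K q -> q.1 x + q.2 <= p.1 x + p.2.

Lemma attainedU (K L : set (dual X * R)) :
  attained K -> attained L -> attained (K `|` L).
Proof.
move=> aK aL x [p0 p0KL].
have [K0|/set0P/(aK x)[p Kp pmax]] := eqVneq K set0.
  by move: p0KL; rewrite K0 set0U => Lp0; apply: aL; exists p0.
have [L0|/set0P/(aL x)[q Lq qmax]] := eqVneq L set0.
  by rewrite L0 setU0; exists p.
have [pq|qp] := leP (p.1 x + p.2) (q.1 x + q.2).
  exists q; first by right.
  by move=> r [/pmax rp|/qmax//]; exact: le_trans rp pq.
exists p; first by left.
by move=> r [/pmax//|/qmax rq]; exact: le_trans rq (ltW qp).
Qed.

Lemma attained_compact (A : set (dual X)) (a : R) (k : dual X -> R) :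
  compact (A : set (weak_star X)) -> continuous (k : weak_star X -> R^o) ->
  attained [set (a *: f, k f) | f in A].
Proof.
move=> cA ck x [_ [f0 Af0 _]].
have cg : continuous (fun f : weak_star X => a * (f : dual X) x + k f : R^o).
  move=> f; apply: (@cvgD _ R^o) (ck f).
  exact: (cvgMl_tmp (@weak_star_eval_continuous _ _ x f)).
have [|f /set_mem Af fmax] := @compact_EVT_max (weak_star X) R _ A _ cA
    (continuous_subspaceT cg).
  by exists f0.
exists (a *: f, k f); first by exists f.
by move=> _ [g Ag <-] /=; apply: fmax; exact: mem_set.
Qed.

End Attained.

(** * Preduals of [l1] *)

Section L1Delta.
Context {R : realType}.

Lemma l1_sumE (I : Type) (r : seq I) (F : I -> l1 R) k :
  (\sum_(i <- r) F i) k = \sum_(i <- r) F i k.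
Proof. by elim/big_rec2: _ => [|i y1 y2 _ <-]. Qed.

Lemma delta_summable i : (fun k => (k == i)%:R : R^o) \in @summable_seq R.
Proof.
apply/summable_seqP; apply/(cvgP (1 : R^o)); apply: cvg_near_cst.
near=> n; rewrite /series/= (bigD1_seq i) ?iota_uniq//=; last first.
  by rewrite mem_index_iota/=; near: n; exact: nbhs_infty_gt.
rewrite eqxx normr1 big1 ?addr0// => j /negbTE ->; exact: normr0.
Unshelve. all: by end_near. Qed.

Definition l1_delta i : l1 R := L1 (delta_summable i).

End L1Delta.

Section Predual.
Context {R : realType} {X : completeNormedModType R}.
Variable J : {linear dual X -> l1 R}.
Hypothesis J_isometric : isometric J.
Hypothesis J_bijective : bijective J.
Implicit Types (f : dual X) (x : X).

Definition coord f i : R := J f i.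

(** Defined by choice, since an inverse of [J] is only known to exist; [coord_basis] shows that the
    choice succeeds. *)
Definition basis i : dual X := xget 0 [set f | J f = l1_delta i].
Local Notation e := basis.

Lemma coord_basis i k : coord (e i) k = (k == i)%:R.
Proof.
suff eE : J (e i) = l1_delta i by rewrite /coord eE.
rewrite /basis; case: xgetP => // h; case: J_bijective => K JK KJ.
by case: (h (K (l1_delta i))); rewrite /= KJ.
Qed.

Lemma coord_inj f g : (forall i, coord f i = coord g i) -> f = g.
Proof. by move=> fg; apply: (bij_inj J_bijective); exact: l1P. Qed.

Lemma J_normE f : `|f| = l1_norm (J f).
Proof. by rewrite -J_isometric. Qed.

Lemma coordD f g i : coord (f + g) i = coord f i + coord g i.
Proof. by rewrite /coord linearD. Qed.

Lemma coordZ c f i : coord (c *: f) i = c * coord f i.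
Proof. by rewrite /coord linearZ. Qed.

Lemma coordN f i : coord (- f) i = - coord f i.
Proof. by rewrite /coord linearN. Qed.

Lemma coord0 i : coord 0 i = 0.
Proof. by rewrite /coord linear0. Qed.

Lemma coord_sum (I : Type) (r : seq I) (F : I -> dual X) k :
  coord (\sum_(i <- r) F i) k = \sum_(i <- r) coord (F i) k.
Proof. by rewrite /coord linear_sum l1_sumE. Qed.

Lemma coord_summable f : series (fun i => `|coord f i|) @ \oo --> `|f|.
Proof. by rewrite J_normE; exact: (@l1_summable _ (J f)). Qed.

Lemma sum_coord_le f n : \sum_(i < n) `|coord f i| <= `|f|.
Proof. by rewrite J_normE -(big_mkord xpredT (fun i => `|coord f i|)); exact: l1_norm_ge. Qed.

Definition partial f n : dual X := \sum_(i < n) coord f i *: e i.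

Lemma coord_comb (c : nat -> R) n k :
  coord (\sum_(i < n) c i *: e i) k = if (k < n)%N then c k else 0.
Proof.
rewrite coord_sum; under eq_bigr do rewrite coordZ coord_basis.
case: ifPn => kn.
  rewrite (bigD1 (Ordinal kn))//= eqxx mulr1 big1 ?addr0// => i ik.
  by rewrite (_ : (k == i) = false) ?mulr0//; apply: contraNF ik => /eqP ki; apply/eqP/val_inj.
rewrite big1// => i _; rewrite (_ : (k == i) = false) ?mulr0//.
by apply: contraNF kn => /eqP ->.
Qed.

Lemma combE (c : nat -> R) n x : (\sum_(i < n) c i *: e i : dual X) x = \sum_(i < n) c i * e i x.
Proof. by elim/big_rec2: _ => [|i y1 y2 _ <-]. Qed.

Lemma partial_norm f n : `|f - partial f n| <= `|f| - \sum_(i < n) `|coord f i|.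
Proof.
rewrite J_normE; apply: l1_norm_le => m.
rewrite [leLHS](_ : _ = \sum_(0 <= k < m) if (k < n)%N then 0 else `|coord f k|); last first.
  apply: eq_bigr => k _; rewrite -[J _ k]/(coord _ k) coordD coordN coord_comb.
  by case: ifP => _; rewrite ?subrr ?normr0 ?subr0.
apply: (@le_trans _ _ (\sum_(i < maxn m n) `|coord f i| - \sum_(i < n) `|coord f i|)).
  rewrite lerBrDl -!(big_mkord xpredT (fun i => `|coord f i|)).
  rewrite (@big_cat_nat _ _ _ n 0 (maxn m n))//= ?leq_maxr// lerD2l.
  have [mn|nm] := leqP m n.
    rewrite big1_seq ?sumr_ge0// => i; rewrite mem_index_iota/= => im.
    by rewrite (leq_trans im mn).
  rewrite (@big_cat_nat _ _ _ n 0 m)//= ?(ltnW nm)// big1_seq ?add0r; last first.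
    by move=> i; rewrite mem_index_iota/= => ->.
  by apply: ler_sum_nat => // i /andP[ni _]; rewrite ltnNge ni.
by rewrite lerD2r sum_coord_le.
Qed.

Lemma sum_coord_cvg f : (fun n => \sum_(i < n) `|coord f i|) @ \oo --> `|f|.
Proof.
have := @coord_summable f; rewrite (_ : series _ = (fun n => \sum_(i < n) `|coord f i|))//.
by apply/funext => n; rewrite /series/= big_mkord.
Qed.

Lemma partial_cvg f : (fun n => `|f - partial f n|) @ \oo --> (0 : R).
Proof.
apply: (@cvg0_le_norm _ R^o _ (fun n => `|f| - \sum_(i < n) `|coord f i|)).
  by move=> n; rewrite normr_id; exact: partial_norm.
have := cvgB (cvg_cst `|f|) (@sum_coord_cvg f); rewrite subrr; exact.
Qed.

Lemma eval_partial f x n : `|f x - \sum_(i < n) coord f i * e i x| <= `|f - partial f n| * `|x|.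
Proof. by rewrite -combE; exact: dual_norm_bound (f - partial f n) x. Qed.

Lemma eval_cvg f x : (fun n => \sum_(i < n) coord f i * e i x) @ \oo --> f x.
Proof.
apply/subr_cvg0/(@cvg0_le_norm _ R^o _ (fun n => `|f - partial f n| * `|x|)).
  by move=> n; rewrite distrC; exact: eval_partial.
by rewrite -(mul0r `|x|); apply: cvgMr_tmp; exact: partial_cvg.
Qed.

Lemma basis_norm i : `|e i| = 1.
Proof.
apply/eqP; rewrite eq_le; apply/andP; split.
  rewrite J_normE; apply: l1_norm_le => n; rewrite /series/=.
  rewrite big_mkord; under eq_bigr do rewrite -[J _ _]/(coord _ _) coord_basis.
  have [ni|ni] := ltnP i n.
    rewrite (bigD1 (Ordinal ni))//= eqxx normr1 big1 ?addr0// => k.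
    by rewrite -val_eqE/= => /negbTE ->; exact: normr0.
  rewrite big1// => k _; rewrite ltn_eqF ?(leq_trans (ltn_ord k))//; exact: normr0.
have := sum_coord_le (e i) i.+1; rewrite big_ord_recr/= coord_basis eqxx normr1.
by apply: le_trans; rewrite lerDr sumr_ge0.
Qed.

Lemma basis_le i x : `|e i x| <= `|x|.
Proof. by have := dual_norm_bound (e i) x; rewrite basis_norm mul1r. Qed.

(* Equality case of [f x <= \sum_i |coord f i| * |e i x| <= 1]. *)
Lemma norming_coord f x : `|f| <= 1 -> (forall i, `|e i x| <= 1) -> f x = 1 ->
  forall i, coord f i * e i x = `|coord f i|.
Proof.
move=> f1 x1 fx i.
have le k : coord f k * e k x <= `|coord f k|.
  by rewrite (le_trans (ler_norm _))// normrM ler_piMr.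
(* A strict deficit at one index survives in all later partial sums and keeps [f x] below 1. *)
apply/eqP; rewrite eq_le le/= leNgt -subr_gt0; apply/negP => d0.
suff : f x <= 1 - (`|coord f i| - coord f i * e i x) by rewrite fx; lra.
rewrite -(cvg_lim (@Rhausdorff R) (@eval_cvg f x))//.
apply: limr_le; first by apply: cvgP; exact: (@eval_cvg f x).
near=> n.
have ni : (i < n)%N by near: n; exact: nbhs_infty_gt.
have := sum_coord_le f n; rewrite (bigD1 (Ordinal ni))//= => le1.
rewrite (bigD1 (Ordinal ni))//=.
have : \sum_(k < n | k != Ordinal ni) coord f k * e k x <=
    \sum_(k < n | k != Ordinal ni) `|coord f k|.
  by apply: ler_sum => k _; exact: le.
lra.
Unshelve. all: by end_near. Qed.

(** Hahn-Banach provides a norming functional; by [norming_coord], every index of its support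
    attains the norm. *)
Lemma norm_attained x : exists i, `|e i x| = `|x|.
Proof.
have [->|x0] := eqVneq x 0; first by exists 0%N; rewrite linear0 !normr0.
have nx : 0 < `|x| by rewrite normr_gt0.
have sn : sublinear (fun x : X => `|x|).
  split; [exact: normr0|exact: ler_normD|move=> t y t0].
  by rewrite normrZ gtr0_norm.
have [l [lin ln lx]] := hahn_banach x sn.
have ln' y : `|l y| <= `|y|.
  rewrite ler_norml ln andbT lerNl -[leRHS]normrN; apply: le_trans (ln (- y)).
  pose L := GRing.isLinear.Build R X R^o _ l lin.
  pose l' : {linear X -> R^o} := HB.pack l L.
  by rewrite -[l]/(l' : X -> R^o) linearN.
have [|f fE] := @dual_of_bounded _ _ l 1 lin; first by move=> y; rewrite mul1r.
have f1 : `|f| <= 1.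
  by apply: dual_norm_le_bound => // y; rewrite fE mul1r.
pose x' := `|x|^-1 *: x.
have fx' : f x' = 1 by rewrite dual_scale fE lx mulVf ?gt_eqF.
have nx' : `|x'| = 1 by rewrite normrZ normfV normr_id mulVf ?gt_eqF.
have nc : forall i, coord f i * e i x' = `|coord f i|.
  by apply: norming_coord => // i; rewrite (le_trans (basis_le i x'))// nx'.
have [i fi] : exists i, coord f i != 0.
  apply/not_existsP => f0; have f00 : f = 0.
    by apply: coord_inj => i; rewrite coord0; have /negP := f0 i; rewrite negbK => /eqP.
  by move: fx'; rewrite f00 => /eqP; rewrite eq_sym oner_eq0.
exists i; have := nc i => /(congr1 Num.norm); rewrite normrM normr_id.
rewrite -[RHS]mulr1 => /mulfI; rewrite normr_eq0 => /(_ fi).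
rewrite dual_scale normrM normfV normr_id => /(congr1 ( *%R `|x|)).
by rewrite mulrA mulfV ?gt_eqF// mul1r mulr1.
Qed.

Lemma norm_le_basis x M : (forall i, `|e i x| <= M) -> `|x| <= M.
Proof. by move=> xM; have [i <-] := norm_attained x; exact: xM. Qed.

(* Helly's theorem for an element [b] of the bidual [l_infty]. *)
Lemma helly (b : nat -> R) n M eta :
  0 < eta -> (forall i, `|b i| <= M) ->
  exists2 x, `|x| <= M + eta & forall i, (i < n)%N -> `|e i x - b i| <= eta.
Proof.
move=> eta0 bM.
have M0 : 0 <= M by exact: le_trans (bM 0%N).
(* With this penalty, an [err] value below [M + eta] forces the deviation sum down to [eta]. *)
pose C := (M + eta) / eta.
have C0 : 0 <= C by rewrite divr_ge0 ?addr_ge0 ?(ltW eta0).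
pose err (a : 'rV[R]_n) x := `|x| + C * \sum_(i < n) `|e i x - a 0 i|.
have err0 a x : 0 <= err a x.
  by apply: addr_ge0 => //; apply: mulr_ge0 => //; apply: sumr_ge0.
pose q a := inf (range (err a)).
have qle a x : q a <= err a x by apply: ge_inf; [exists 0 => _ [y _ <-]|exists x].
have qge a r : (forall x, r <= err a x) -> r <= q a.
  by move=> h; apply: lb_le_inf => [|_ [x _ <-]//]; exists (err a 0), 0.
have sq : sublinear q.
  split.
  - apply/eqP; rewrite eq_le (qge 0 0)// andbT; apply: le_trans (qle 0 0) _.
    rewrite /err normr0 add0r big1 ?mulr0// => i _.
    by rewrite linear0 mxE subrr normr0.
  - move=> a a'; rewrite -lerBlDr; apply: (qge a) => x.
    rewrite lerBlDr -lerBlDl; apply: (qge a') => y; rewrite lerBlDl.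
    apply: le_trans (qle _ (x + y)) _; rewrite /err addrACA -mulrDr -big_split/=.
    rewrite lerD ?ler_normD// ler_wpM2l// ler_sum// => i _.
    by rewrite linearD mxE opprD addrACA ler_normD.
  - move=> t a t0; rewrite -ler_pdivrMl//; apply: (qge a) => x; rewrite ler_pdivrMl//.
    apply: le_trans (qle _ (t *: x)) _; rewrite /err mulrDr normrZ gtr0_norm//.
    rewrite mulrCA lerD2l ler_wpM2l// mulr_sumr ler_sum// => i _.
    by rewrite dual_scale mxE -mulrBr normrM gtr0_norm.
pose a : 'rV[R]_n := \row_i b i.
have [l [lin lq lqa]] := hahn_banach a sq.
pose L := GRing.isLinear.Build R 'rV[R]_n R^o _ l lin.
pose l' : {linear 'rV[R]_n -> R^o} := HB.pack l L.
have lE v : l v = \sum_(i < n) v 0 i * l (delta_mx 0 i).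
  by rewrite -[l]/(l' : _ -> R^o) {1}(row_sum_delta v) linear_sum;
    apply: eq_bigr => i _; rewrite linearZ.
pose c k := if insub k is Some i then l (delta_mx 0 i) else 0.
have cE (i : 'I_n) : l (delta_mx 0 i) = c i by rewrite /c valK.
(* The functional dominated by [q] becomes a combination of the [e i] of norm at most 1, and the
   bound on [b] then gives [q a <= M]. *)
pose f : dual X := \sum_(i < n) c i *: e i.
have fE x : f x = l (\row_i e i x).
  by rewrite lE combE; apply: eq_bigr => i _; rewrite mxE mulrC cE.
have flex x : f x <= `|x|.
  rewrite fE; apply: le_trans (lq _) (le_trans (qle _ x) _).
  by rewrite /err big1 ?mulr0 ?addr0// => i _; rewrite mxE subrr normr0.
have f1 : `|f| <= 1.
  apply: dual_norm_le_bound => // x; rewrite mul1r ler_norml flex andbT lerNl.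
  by have := flex (- x); rewrite linearN normrN.
have qa : q a <= M.
  rewrite -lqa lE.
  apply: (@le_trans _ _ (\sum_(i < n) M * `|coord f i|)).
    apply: ler_sum => i _; rewrite mxE cE coord_comb ltn_ord.
    by rewrite (le_trans (ler_norm _))// normrM ler_wpM2r.
  by rewrite -mulr_sumr ler_piMr// (le_trans (sum_coord_le f n)).
have [_ [x _ <-] xlt] : exists2 r, range (err a) r & r < M + eta.
  apply: inf_lt; first by exists (err a 0), 0.
  by rewrite (le_lt_trans qa)// ltrDl.
have sum0 : 0 <= \sum_(i < n) `|e i x - a 0 i| by rewrite sumr_ge0.
exists x; first by rewrite (le_trans _ (ltW xlt))// lerDl mulr_ge0.
move=> i ni; have : C * \sum_(i < n) `|e i x - a 0 i| <= M + eta.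
  by rewrite (le_trans _ (ltW xlt))// lerDr.
rewrite /C mulrAC ler_pdivrMr// ler_pM2l ?ltr_wpDl//; apply: le_trans.
by rewrite (bigD1 (Ordinal ni))//= mxE lerDl sumr_ge0.
Qed.

(** * Extreme points of the dual ball and of its norming faces *)

Lemma norm_le_coord f M : (forall n, \sum_(i < n) `|coord f i| <= M) -> `|f| <= M.
Proof.
move=> fM; rewrite J_normE; apply: l1_norm_le => n.
by rewrite /series/= big_mkord; exact: fM.
Qed.

Lemma norm_sub_coord f i : `|f - coord f i *: e i| <= `|f| - `|coord f i|.
Proof.
apply: norm_le_coord => n; pose m := maxn n i.+1.
have im : (i < m)%N by rewrite leq_maxr.
set g := f - _.
have gk k : coord g k = if k == i then 0 else coord f k.
  rewrite coordD coordN coordZ coord_basis; case: eqP => [->|_].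
    by rewrite mulr1 subrr.
  by rewrite mulr0 subr0.
apply: (@le_trans _ _ (\sum_(k < m) `|coord g k|)).
  rewrite -!(big_mkord xpredT (fun k => `|coord g k|)).
  by rewrite (@big_cat_nat _ _ _ n 0 m)//= ?leq_maxl// lerDl sumr_ge0.
rewrite lerBrDr; apply: le_trans (sum_coord_le f m).
rewrite (bigD1 (Ordinal im))//= gk eqxx normr0 add0r [leRHS](bigD1 (Ordinal im))//= [leLHS]addrC.
rewrite lerD2l ler_sum// => k; rewrite -val_eqE/= => /negbTE ki.
by rewrite gk ki.
Qed.

Lemma coord_le f i : `|coord f i| <= `|f|.
Proof. by have := norm_sub_coord f i; have := normr_ge0 (f - coord f i *: e i); lra. Qed.

Lemma coord_unit f i : `|f| <= 1 -> 1 <= `|coord f i| -> f = coord f i *: e i.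
Proof.
move=> f1 fi; apply/eqP; rewrite -subr_eq0 -normr_le0.
by apply: le_trans (norm_sub_coord f i) _; lra.
Qed.

(** The [i]-th coordinates of both endpoints must have absolute value 1, which leaves no mass for
    the other coordinates. *)
Lemma basis_extreme (a : R) i : `|a| = 1 ->
  extreme_points (unit_ball (dual X)) (a *: e i).
Proof.
move=> a1; split; first by rewrite /unit_ball/= normrZ a1 basis_norm mulr1.
have aa : a * a = 1 by rewrite -expr2 -real_normK ?num_real// a1 expr1n.
move=> f g t; rewrite /unit_ball/= => f1 g1 t0 t1 aE.
have := congr1 (fun h => a * coord h i) aE.
rewrite coordZ coord_basis eqxx mulr1 aa coordD !coordZ => E.
have le1 h : `|h| <= 1 -> a * coord h i <= 1.
  move=> h1; rewrite (le_trans (ler_norm _))// normrM a1 mul1r.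
  exact: le_trans (coord_le h i) h1.
have lef := le1 f f1; have leg := le1 g g1.
have fi : a * coord f i = 1 by nra.
have gi : a * coord g i = 1 by nra.
have unit_ h : `|h| <= 1 -> a * coord h i = 1 -> h = a *: e i.
  move=> h1 hi; have hia : coord h i = a by rewrite -[LHS]mul1r -aa -mulrA hi mulr1.
  by rewrite -hia; apply: coord_unit => //; rewrite hia a1.
by split; exact: unit_.
Qed.

Lemma normingP x f : `|x| = 1 -> norming x f <-> `|f| <= 1 /\ f x = 1.
Proof.
move=> x1; split; first by move=> [+ ->]; rewrite /unit_sphere/= => ->.
move=> [f1 fx]; split=> //; apply/eqP; rewrite eq_le f1/=.
by have := dual_norm_bound f x; rewrite fx x1 mulr1 normr1.
Qed.

Lemma extreme_norming x f : `|x| = 1 ->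
  extreme_points (unit_ball (dual X)) f -> f x = 1 -> extreme_points (norming x) f.
Proof.
move=> x1 [f1 fext] fx; split; first exact/normingP.
by move=> g h t /(normingP _ x1)[g1 _] /(normingP _ x1)[h1 _]; exact: fext.
Qed.

(** By the equality case [norming_coord], this sign makes [a *: e i] take the value 1 at [x]. *)
Lemma norming_sign x f i : `|x| = 1 -> `|f| <= 1 -> f x = 1 -> coord f i != 0 ->
  let a := coord f i / `|coord f i| in
  `|a| = 1 /\ extreme_points (norming x) (a *: e i).
Proof.
move=> x1 f1 fx fi a.
have nfi : `|coord f i| != 0 by rewrite normr_eq0.
have a1 : `|a| = 1 by rewrite normrM normfV normr_id mulfV.
split=> //; apply: extreme_norming => //; first exact: basis_extreme.
rewrite dualZE /a mulrAC norming_coord ?mulfV// => k.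
by rewrite (le_trans (basis_le k x))// x1.
Qed.

(** If a nonzero coordinate has absolute value below 1, [f] is a proper mixture of [a *: e i] and
    its normalized remainder; both lie in the face, so extremality identifies [f] with
    [a *: e i]. *)
Lemma extreme_normingE x f : `|x| = 1 -> extreme_points (norming x) f ->
  exists a i, `|a| = 1 /\ f = a *: e i.
Proof.
move=> x1 [/(normingP _ x1)[f1 fx] fext].
have [i fi] : exists i, coord f i != 0.
  apply/not_existsP => f0; have f00 : f = 0.
    by apply: coord_inj => i; rewrite coord0; have /negP := f0 i; rewrite negbK => /eqP.
  by move: fx; rewrite f00 => /eqP; rewrite eq_sym oner_eq0.
have [a1 aext] := norming_sign x1 f1 fx fi; set a := coord f i / _ in a1 aext.
have [t1|t1] := leP 1 `|coord f i|.
  exists (coord f i), i; split; last exact: coord_unit.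
  by apply/eqP; rewrite eq_le t1 (le_trans (coord_le f i)).
exists a, i; split=> //.
pose t := `|coord f i|; have t0 : 0 < t by rewrite normr_gt0.
have t1' : 0 < 1 - t by rewrite subr_gt0.
have atE : coord f i = t * a by rewrite /a mulrCA mulfV ?mulr1// gt_eqF.
pose g : dual X := (1 - t)^-1 *: (f - coord f i *: e i).
have fE : f = t *: (a *: e i) + (1 - t) *: g.
  by rewrite /g !scalerA mulfV ?gt_eqF// scale1r -atE addrC subrK.
have ax : (a *: e i) x = 1 by case: aext => /(normingP _ x1)[].
have gx : g x = 1.
  have := congr1 (fun h : dual X => h x) fE.
  rewrite -[X in _ = X]/(t * (a *: e i) x + (1 - t) * g x) fx ax => E.
  have : (1 - t) * g x = (1 - t) * 1 by lra.
  by move/mulfI; apply; rewrite gt_eqF.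
have gn : norming x g.
  apply/normingP => //; split=> //; rewrite /g normrZ normfV gtr0_norm//.
  rewrite mulrC ler_pdivrMr// mul1r; have := norm_sub_coord f i; rewrite /t; lra.
have [] := fext _ _ t aext.1 gn t0 _ fE; first by lra.
by move=> <-.
Qed.

(** * Prescribing values on weak-star compact sets of functionals *)

Section Extension.
(** The Boolean is the prescribed value: 1 on [F true], 0 on [F false]. The elements of [s] share
    the budget [c] with the distance to [y]. *)
Variables (y : X) (s : seq X) (c : R) (F : bool -> set (dual X)).
Definition load f : R := \sum_(z <- s) `|f z|.

Hypothesis F_compact : forall t, compact (F t : set (weak_star X)).
Hypothesis F_ball : forall t f, F t f -> `|f| <= 1.

Lemma load_continuous : continuous (load : weak_star X -> R^o).
Proof.
rewrite /load; elim: s => [|z r IH].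
  rewrite (_ : (fun f => _) = cst 0); first exact: cst_continuous.
  by apply/funext => f; rewrite big_nil.
rewrite (_ : (fun f => _) = (fun f : dual X => `|f z| + \sum_(z <- r) `|f z|)); last first.
  by apply/funext => f; rewrite big_cons.
move=> f; apply: (@cvgD _ R^o) (IH f).
exact: cvg_norm (@weak_star_eval_continuous _ _ z f).
Qed.

Lemma load_partial f n : load f <=
  \sum_(i < n) `|coord f i| * load (e i) + `|f - partial f n| * \sum_(z <- s) `|z|.
Proof.
rewrite /load; under [X in _ <= X + _]eq_bigr do rewrite mulr_sumr.
rewrite exchange_big mulr_sumr -big_split/=; apply: ler_sum => z _.
have := eval_partial f z n; rewrite ler_distlC => h.
apply: (@le_trans _ _ (`|\sum_(i < n) coord f i * e i z| + `|f - partial f n| * `|z|)).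
  rewrite -lerBlDl; apply: le_trans (lerB_dist _ _) (eval_partial f z n).
rewrite lerD2r (le_trans (ler_norm_sum _ _ _))// ler_sum// => i _.
by rewrite normrM.
Qed.

Section Step.
Variable b : nat -> R.
Hypothesis b_load : forall i, `|b i - e i y| + load (e i) <= c.
Hypothesis F_sum : forall t f, F t f ->
  (fun n => \sum_(i < n) coord f i * b i) @ \oo --> (t%:R : R).

Let c_ge0 : 0 <= c.
Proof. by apply: le_trans (b_load 0%N); rewrite addr_ge0 ?sumr_ge0. Qed.

(** [simons] is applied to Helly approximants of [b]: each inequality holds in the limit by [b_load]
    and [F_sum], and all hold simultaneously up to [eta]. *)
Lemma extension_step x0 (rho eta : R) : 0 < eta -> (forall i, `|b i - e i x0| <= rho) ->
  exists x, [/\ `|x - x0| <= rho + eta,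
    forall f, `|f| <= 1 -> f (x - y) + load f <= c + eta &
    forall t f, F t f -> `|f x - t%:R| <= eta].
Proof.
move=> eta0 b_x0.
pose h : R := 2^-1.
have hn0 n : 0 < h ^+ n by rewrite exprn_gt0 ?invr_gt0.
have rho0 : 0 <= rho by exact: le_trans (b_x0 0%N).
pose D n := [set x | `|x - x0| <= rho + eta /\
  forall i, (i < n)%N -> `|e i x - b i| <= h ^+ n].
(* [piece d t] encodes [(-1) ^+ d * (f x - t)]; the two signs together control the absolute
   value. *)
pose piece (d t : bool) : set (dual X * R) :=
  [set ((-1 : R) ^+ d *: f, - ((-1) ^+ d * t%:R)) | f in F t].
(* [load] is not linear in [f], but it is constant in [x] and so may enter the second component. *)
pose C0 : set (dual X * R) := [set (1 *: f, load f - f y - c) | f in unit_ball (dual X)].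
pose C := C0 `|` ((piece false true `|` piece true true) `|`
                  (piece false false `|` piece true false)).
have C_att : attained C.
  have pa d t : attained (piece d t).
    apply: (@attained_compact _ _ (F t) ((-1) ^+ d) (fun=> - ((-1) ^+ d * t%:R))) => //.
    exact: cst_continuous.
  apply: attainedU; last by do ! apply: attainedU.
  apply: (@attained_compact _ _ _ 1 (fun f => load f - f y - c)).
    exact: weak_star_ball_compact.
  move=> f; apply: (@cvgB _ R^o) (@cst_continuous _ _ c f).
  exact: (@cvgB _ R^o) (@load_continuous f) (@weak_star_eval_continuous _ _ y f).
pose K := `|x0| + rho + eta.
(* The cost, for [x] in [D n], of truncating [f] to its first [n] coordinates and of replacing
   [e i x] by [b i]. *)
pose G f n := `|f - partial f n| * (K + `|y| + \sum_(z <- s) `|z|) + h ^+ n.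
have G_cvg f : G f @ \oo --> (0 : R).
  have hcvg : (fun n => h ^+ n) @ \oo --> (0 : R).
    by apply: cvg_expr; rewrite gtr0_norm ?invr_gt0// invf_lt1 ?ltr1n.
  have := cvgD (cvgMr_tmp (b := K + `|y| + \sum_(z <- s) `|z|) (@partial_cvg f)) hcvg.
  rewrite mul0r addr0; exact.
have D_G f n x : `|f| <= 1 -> D n x ->
    `|f x - \sum_(i < n) coord f i * b i| <= `|f - partial f n| * K + h ^+ n.
  move=> f1 [xx0 xb].
  have xK : `|x| <= K.
    have := ler_normD x0 (x - x0); rewrite addrC subrK /K; lra.
  rewrite -(subrK (\sum_(i < n) coord f i * e i x) (f x)) -addrA.
  rewrite (le_trans (ler_normD _ _))// lerD//.
    by rewrite (le_trans (eval_partial _ _ _))// ler_wpM2l.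
  rewrite -sumrB; apply: le_trans (ler_norm_sum _ _ _) _.
  apply: (@le_trans _ _ (\sum_(i < n) `|coord f i| * h ^+ n)).
    by apply: ler_sum => i _; rewrite -mulrBr normrM ler_wpM2l// xb.
  by rewrite -mulr_suml ler_piMl ?(ltW (hn0 n))// (le_trans (sum_coord_le f n)).
have lim_le (u : nat -> R) d : 0 < d -> u @ \oo --> (0 : R) -> exists n, u n <= d.
  move=> d0 /cvgr0Pnorm_le/(_ d d0)/filter_ex[n un]; exists n.
  exact: le_trans (ler_norm _) un.
have [x [xx0 _] xC] : exists2 x, D 0%N x & forall p, C p -> p.1 x + p.2 <= eta.
  apply: (@simons _ _ C D K) => //.
  - move=> x; apply: C_att; exists (1 *: 0, load 0 - (0 : dual X) y - c); left.
    by exists 0 => //; rewrite /unit_ball/= normr0.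
  (* Helly is applied to the difference from [x0], so that [rho] bounds the displacement; the
     minimum serves both conditions of [D n]. *)
  - move=> n; pose eta' := Num.min eta (h ^+ n).
    have eta'0 : 0 < eta' by rewrite lt_min eta0 hn0.
    have [x x1 xb] := @helly (fun i => b i - e i x0) n rho _ eta'0 b_x0.
    exists (x + x0); split; first by rewrite addrK (le_trans x1)// lerD2l ge_min lexx.
    move=> i ni; have := xb i ni; rewrite opprB addrA -[e i x + _]linearD => /le_trans.
    by apply; rewrite ge_min lexx orbT.
  - move=> n.
    have norm_closed (f : X -> R^o) r : continuous f -> closed [set x | `|f x| <= r].
      move=> cf; apply: (@preimage_closed _ _ (fun x => `|f x|) [set r' : R | r' <= r]).
        by move=> z _; apply: cvg_norm; exact: cf.
      exact: closed_le.
    rewrite (_ : D n = [set x | `|x - x0| <= rho + eta] `&`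
        \bigcap_(i in [set i | (i < n)%N]) [set x | `|e i x - b i : R^o| <= h ^+ n])//.
    apply: closedI.
      apply: (@preimage_closed _ _ (fun x => `|x - x0|) [set r' : R | r' <= rho + eta]).
        by move=> z _; apply: cvg_norm; apply: cvgB; [exact: cvg_id|exact: cvg_cst].
      exact: closed_le.
    apply: closed_bigI => i _; apply: norm_closed => z.
    by apply: cvgB; [exact: dual_continuous|exact: cvg_cst].
  - move=> n x x' [h1 h2] [h3 h4].
    have mid (V : normedModType R) (v v' w : V) (r : R) : `|v - w| <= r -> `|v' - w| <= r ->
        `|2^-1 *: (v + v') - w| <= r.
      move=> vr v'r; have -> : 2^-1 *: (v + v') - w = 2^-1 *: ((v - w) + (v' - w)).
        rewrite addrACA -opprD -mulr2n [RHS]scalerBr -[w *+ 2]scaler_nat scalerA.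
        by rewrite mulVf ?pnatr_eq0// scale1r.
      rewrite normrZ ger0_norm ?invr_ge0//.
      have := ler_normD (v - w) (v' - w); lra.
    split; first exact: mid.
    move=> i ni; rewrite dual_scale linearD.
    exact: (mid R^o _ _ _ _ (h2 i ni) (h4 i ni)).
  - move=> n x [h1 h2]; split=> // i ni; apply: le_trans (h2 i (ltnW ni)) _.
    by rewrite exprS ler_piMl ?ltW// invf_lt1 ?ltr1n.
  - move=> x [+ _]; have := ler_normD x0 (x - x0); rewrite addrC subrK /K; lra.
  - move=> p Cp d d0.
    have pieceP t f : F t f -> exists n, forall x, D n x -> `|f x - t%:R| <= d.
      move=> Ff; have f1 := F_ball Ff.
      have [|n nd] := lim_le (fun n => G f n + `|\sum_(i < n) coord f i * b i - t%:R|) d d0.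
        have := cvgD (G_cvg f) (cvg_norm (cvgB (F_sum Ff) (cvg_cst (t%:R : R)))).
        rewrite subrr normr0 addr0; exact.
      exists n => x Dx; apply: le_trans nd.
      rewrite -(subrK (\sum_(i < n) coord f i * b i) (f x)) -addrA.
      rewrite (le_trans (ler_normD _ _))// lerD2r (le_trans (D_G _ _ _ f1 Dx))//.
      by rewrite lerD2r ler_wpM2l// -addrA lerDl addr_ge0 ?sumr_ge0.
    have pieceS dd t : piece dd t p -> exists n, forall x, D n x -> p.1 x + p.2 <= d.
      move=> [f Ff <-]; have [n nP] := pieceP _ _ Ff; exists n => x Dx.
      apply: le_trans (nP x Dx).
      rewrite dualZE -[X in X <= _]mulrBr.
      by rewrite (le_trans (ler_norm _))// normrM normrX normrN1 expr1n mul1r.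
    case: Cp => [[f f1 <-]|[[|]|[|]]]; [|exact: pieceS..].
    have [n nd] := lim_le _ _ d0 (G_cvg f).
    exists n => x Dx; apply: le_trans nd; rewrite scale1r/=.
    have := D_G _ _ _ f1 Dx; rewrite ler_distlC => /andP[+ _].
    have := eval_partial f y n; rewrite ler_distlC => /andP[_ +].
    have := load_partial f n.
    have : \sum_(i < n) coord f i * b i - \sum_(i < n) coord f i * e i y +
        \sum_(i < n) `|coord f i| * load (e i) <= c.
      rewrite -sumrB -big_split/=.
      apply: (@le_trans _ _ (\sum_(i < n) `|coord f i| * c)).
        apply: ler_sum => i _; rewrite -mulrBr.
        apply: le_trans (ler_wpM2l (normr_ge0 _) (b_load i)).
        by rewrite [leRHS]mulrDr lerD2r (le_trans (ler_norm _))// normrM.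
      by rewrite -mulr_suml ler_piMl// (le_trans (sum_coord_le f n)).
    rewrite /G; lra.
exists x; split=> //.
- move=> f f1; have := xC (1 *: f, load f - f y - c); rewrite scale1r linearB/=.
  have Cf : C (f, load f - f y - c) by left; exists f; rewrite ?scale1r.
  move=> /(_ Cf); lra.
- move=> t f Ff.
  have Cf (d : bool) : C ((-1) ^+ d *: f, - ((-1) ^+ d * t%:R)).
    by right; case: t Ff => Ff; [left|right]; case: d; (try by left; exists f); right; exists f.
  have xC' (d : bool) : (-1) ^+ d * (f x - t%:R) <= eta by rewrite mulrBr; exact: xC (Cf d).
  by have := xC' false; have := xC' true; rewrite expr0 expr1 ler_norml; lra.
Qed.

End Step.

(** Thus [F] determines [b i] at every index occurring in [F], and changing the other entries does
    not affect the pairings. *)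
Hypothesis F_supp : forall t f, F t f -> forall i, coord f i != 0 ->
  exists u, F u (e i) \/ F u (- e i).

(* Iterating [extension_step], with [b] replaced at each stage by its
   truncation towards the previous approximation. *)
Theorem extension (b : nat -> R) :
  (forall i, `|b i - e i y| + load (e i) <= c) ->
  (forall t f, F t f -> (fun n => \sum_(i < n) coord f i * b i) @ \oo --> (t%:R : R)) ->
  exists x, (forall f, `|f| <= 1 -> `|f (x - y)| + load f <= c) /\
    forall t f, F t f -> f x = t%:R.
Proof.
move=> b_load F_sum.
pose P x (eta : R) := (forall f, `|f| <= 1 -> f (x - y) + load f <= c + eta) /\
  forall t f, F t f -> `|f x - t%:R| <= eta.
have load0 f : 0 <= load f by rewrite sumr_ge0.
have loadN f : load (- f) = load f by apply: eq_bigr => z _; rewrite normrN.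
have [x0 Px0] : exists x0, P x0 1.
  have [x|x [_ h1 h2]] := @extension_step b b_load F_sum y c 1 ltr01; last by exists x.
  by rewrite (le_trans _ (b_load x))// lerDl.
(* For a signed [e i] in [F t] the pairing condition reads [b i = t] or [b i = - t], so [P] already
   puts [e i x] close to [b i]. *)
have bE t i x eta : F t (e i) \/ F t (- e i) -> P x eta -> `|b i - e i x| <= eta.
  have cvg_b (a : R) : (fun n => \sum_(k < n) a * coord (e i) k * b k) @ \oo --> a * b i.
    apply: cvg_near_cst; near=> n.
    have ni : (i < n)%N by near: n; exact: nbhs_infty_gt.
    rewrite (bigD1 (Ordinal ni))//= coord_basis eqxx mulr1 big1 ?addr0// => k.
    by rewrite coord_basis -val_eqE/= => /negbTE ->; rewrite mulr0 mul0r.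
  move=> + [_ P2] => -[Fe|Fe].
    have := P2 _ _ Fe; rewrite distrC; suff -> : b i = t%:R by [].
    apply: (@cvg_unique _ (@Rhausdorff R)) (F_sum _ _ Fe).
    by have := cvg_b 1; rewrite mul1r; under eq_fun do under eq_bigr do rewrite mul1r.
  have := P2 _ _ Fe; rewrite -[(- e i) x]/(- e i x) -normrN opprB opprK.
  suff -> : b i = - t%:R by rewrite -opprD normrN.
  apply: (canRL (@opprK _)); apply: (@cvg_unique _ (@Rhausdorff R)) (F_sum _ _ Fe).
  have := cvg_b (-1); rewrite mulN1r; under eq_fun do under eq_bigr do rewrite mulN1r -coordN.
  exact.
have Pstep x eta eta' : 0 < eta -> 0 < eta' -> P x eta ->
    exists x', `|x' - x| <= eta + eta' /\ P x' eta'.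
  move=> eta0 eta'0 Px; have [P1 P2] := Px.
  pose N i := exists u, F u (e i) \/ F u (- e i).
  (* At the other indices, [e i x - e i y] is clipped to radius [c - load (e i)]; by [P] this moves
     it by at most [eta]. *)
  have /choice[b' b'P] : forall i, exists r, [/\ `|r - e i y| + load (e i) <= c,
      `|r - e i x| <= eta & N i -> r = b i].
    move=> i; have [Ni|nNi] := pselect (N i).
      exists (b i); split => //.
      by have [u /bE] := Ni; apply.
    have ri := P1 (e i); rewrite basis_norm lexx linearB in ri; have {}ri := ri isT.
    have ri' := P1 (- e i); rewrite normrN basis_norm lexx loadN in ri'; have {}ri' := ri' isT.
    rewrite (_ : (- e i) (x - y) = - (e i x - e i y)) in ri'; last by rewrite -linearB.
    have r0 : load (e i) <= c by rewrite (le_trans _ (b_load i))// lerDr.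
    suff [w [w1 w2]] : exists w, `|w| <= c - load (e i) /\ `|w - (e i x - e i y)| <= eta.
      exists (w + e i y); split => //; first by rewrite addrK -lerBrDr.
      by move: w2; rewrite opprB addrA.
    have [h1|h1] := leP (e i x - e i y) (c - load (e i)); last first.
      by exists (c - load (e i)); rewrite !ler_norml; split; lra.
    have [h2|h2] := leP (- (c - load (e i))) (e i x - e i y); last first.
      by exists (- (c - load (e i))); rewrite !ler_norml; split; lra.
    by exists (e i x - e i y); rewrite !ler_norml; split; lra.
  have b'_load i : `|b' i - e i y| + load (e i) <= c by have [] := b'P i.
  have b'_sum t f : F t f -> (fun n => \sum_(i < n) coord f i * b' i) @ \oo --> (t%:R : R).
    move=> Ff; suff -> : (fun n => \sum_(i < n) coord f i * b' i) =
      (fun n => \sum_(i < n) coord f i * b i) by exact: F_sum.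
    apply/funext => n; apply: eq_bigr => i _.
    have [->|fi] := eqVneq (coord f i) 0; first by rewrite !mul0r.
    by have [_ _ ->//] := b'P i; exact: F_supp Ff i fi.
  have b'x i : `|b' i - e i x| <= eta by have [] := b'P i.
  have [x' [h1 h2 h3]] := extension_step b'_load b'_sum eta'0 b'x.
  by exists x'.
pose h : R := 2^-1.
have hn0 n : 0 < h ^+ n by rewrite exprn_gt0 ?invr_gt0.
(* Halving the tolerance each time makes the displacements summable. *)
have /choice[next nextP] : forall xn : X * nat, exists x', P xn.1 (h ^+ xn.2) ->
    `|x' - xn.1| <= h ^+ xn.2 + h ^+ xn.2.+1 /\ P x' (h ^+ xn.2.+1).
  move=> [x n] /=; have [Px|nPx] := pselect (P x (h ^+ n)).
    by have [x' Px'] := Pstep _ _ _ (hn0 n) (hn0 n.+1) Px; exists x'.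
  by exists x.
pose u := fix u n : X := if n is m.+1 then next (u m, m) else x0.
have uP n : P (u n) (h ^+ n).
  by elim: n => [|n IH]; [rewrite expr0|have [] := nextP (u n, n) IH].
have uS n : `|u n.+1 - u n| <= h ^+ n + h ^+ n.+1 by have [] := nextP (u n, n) (uP n).
have ucvg : cvgn u.
  apply: (@geometric_step_cvg _ _ _ 2%:R) => n; apply: le_trans (uS n) _.
  have := hn0 n; rewrite -/h exprS /h; lra.
pose x := limn u.
have ev f : (fun n => f (u n)) @ \oo --> f x.
  by apply: continuous_cvg => //; exact: dual_continuous.
have h0 : (fun n => h ^+ n) @ \oo --> (0 : R).
  by apply: cvg_expr; rewrite gtr0_norm ?invr_gt0// invf_lt1 ?ltr1n.
have le1 f : `|f| <= 1 -> f (x - y) + load f <= c.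
  move=> f1; have : (fun n => f (u n) - f y + load f - h ^+ n) @ \oo --> f x - f y + load f - 0.
    by apply: cvgB => //; apply: cvgD; [apply: cvgB|]; [exact: ev|exact: cvg_cst..].
  rewrite subr0 -linearB => h1.
  apply: (cvgr_to_le h1); near=> n.
  by have [/(_ f f1) + _] := uP n; rewrite linearB/=; lra.
exists x; split.
  move=> f f1; have := le1 f f1; have := le1 (- f); rewrite normrN f1 loadN => /(_ isT).
  rewrite (_ : (- f) (x - y) = - f (x - y))// => h1 h2.
  by rewrite -lerBrDr ler_norml; lra.
move=> t f Ff; apply/eqP; rewrite -subr_eq0 -normr_le0.
have : (fun n => `|f (u n) - t%:R| - h ^+ n) @ \oo --> `|f x - t%:R| - 0.
  by apply: cvgB => //; apply: cvg_norm; apply: cvgB; [exact: ev|exact: cvg_cst].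
rewrite subr0 => h1; apply: (cvgr_to_le h1); near=> n.
by have [_ /(_ t f Ff)] := uP n; rewrite subr_le0.
Unshelve. all: by end_near. Qed.

End Extension.

(** * From a face satisfying the conditions to a copy of [c] *)

Section FaceToCopy.
Variables (xbar : X) (v : nat -> dual X).
Hypothesis xbar1 : `|xbar| = 1.
Hypothesis v_inj : injective v.
Hypothesis v_ext : forall n, extreme_points (unit_ball (dual X)) (v n).
Hypothesis v_xbar : forall n, v n xbar = 1.
Let A : set (dual X) := extreme_points (norming xbar).
Hypothesis v_supp : forall n d, weak_star_cluster_points A d ->
  supp (J (v n)) `&` supp (J d) = set0.

Let A_ball f : A f -> `|f| <= 1.
Proof. by move=> [/(normingP _ xbar1)[]]. Qed.

Let A_xbar f : A f -> f xbar = 1.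
Proof. by move=> [/(normingP _ xbar1)[]]. Qed.

Let v_A n : A (v n).
Proof. exact: extreme_norming. Qed.

Lemma face_sign f i : A f -> coord f i != 0 -> `|coord f i| = 1 /\ f = coord f i *: e i.
Proof.
move=> /(extreme_normingE xbar1)[a [k [a1 ->]]].
rewrite coordZ coord_basis; have [->|_] := eqVneq i k; first by rewrite mulr1.
by rewrite mulr0 eqxx.
Qed.

(** The value of [e i] at [xbar] fixes the sign. *)
Lemma face_inj f g i : A f -> A g -> coord f i != 0 -> coord g i != 0 -> f = g.
Proof.
move=> Af Ag fi gi; have [f1 fE] := face_sign Af fi; have [g1 gE] := face_sign Ag gi.
have fx : coord f i * e i xbar = 1 by rewrite -dualZE -fE A_xbar.
have gx : coord g i * e i xbar = 1 by rewrite -dualZE -gE A_xbar.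
have ei : e i xbar != 0.
  by apply: contra_eqN gx => /eqP ->; rewrite mulr0 eq_sym oner_eq0.
suff E : coord f i = coord g i by rewrite fE gE E.
by apply: (mulIf ei); rewrite fx gx.
Qed.

(** Invariant of the construction. The second clause speaks of all of [A], because the next step
    estimates the load at every index occurring in [A]. *)
Let splits (s : seq X) :=
  (forall i, `|e i (xbar - \sum_(z <- s) z)| + \sum_(z <- s) `|e i z| <= 1) /\
  forall f, A f -> forall j, (j < size s)%N -> f (nth 0 s j) = (f == v j)%:R.

Lemma splits_sum s f : splits s -> A f ->
  let k : R := \sum_(j < size s) (f == v j)%:R in
  [/\ \sum_(z <- s) f z = k, \sum_(z <- s) `|f z| = k & (0 <= k <= 1)%R].
Proof.
move=> [s1 s2] Af k.
have E1 : \sum_(z <- s) f z = k.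
  by rewrite (big_nth 0) big_mkord; apply: eq_bigr => j _; rewrite s2.
have E2 : \sum_(z <- s) `|f z| = k.
  by rewrite (big_nth 0) big_mkord; apply: eq_bigr => j _; rewrite s2// normr_nat.
split=> //; apply/andP; split; first by rewrite sumr_ge0.
have [a [i [a1 fE]]] := extreme_normingE xbar1 Af.
apply: le_trans (s1 i); rewrite -E2 -[leLHS]add0r lerD//.
by apply: ler_sum => z _; rewrite fE dualZE normrM a1 mul1r.
Qed.

(** A point of the closure outside [A] without [v n] is a cluster point of [A], so by [v_supp] its
    support misses that of [v n]. *)
Lemma closure_face n f i : closure ((A `\ v n) : set (weak_star X)) f ->
  coord f i != 0 -> exists a, [/\ `|a| = 1, A (a *: e i) & a *: e i <> v n].
Proof.
move=> clf fi.
have [[Af fv]|nAf] := pselect ((A `\ v n) f).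
  have [f1 fE] := face_sign Af fi.
  by exists (coord f i); rewrite -fE; split=> // /fv.
have f_cluster : weak_star_cluster_points A f.
  move=> U Uf; have [g [[Ag gv] Ug]] := clf U Uf.
  by exists g; split=> //; apply/eqP => gf; apply: nAf; rewrite -gf.
have [f1 fx] : `|f| <= 1 /\ f xbar = 1.
  apply: weak_star_closure_norming clf => g [Ag _].
  by split; [exact: A_ball|exact: A_xbar].
have [a1 aA] := norming_sign xbar1 f1 fx fi.
exists (coord f i / `|coord f i|); split=> // av.
have : (supp (J (v n)) `&` supp (J f)) i.
  split=> //; rewrite -av /supp/= -[J _ i]/(coord _ i) coordZ coord_basis eqxx mulr1.
  by rewrite -normr_gt0 a1.
by rewrite v_supp.
Qed.

(** The new [x] is sought near half of the remainder [Y]: with the halved list as load,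
    [|e i (x - Y / 2)|] plus the load is at most 1/2. As [|p| + |q|] is the larger of [|p + q|] and
    [|p - q|], this and the bound on [Y] give the invariant for [Y - x] and [x]. *)
Lemma splits_rcons s : splits s -> exists x, splits (rcons s x).
Proof.
move=> ss; have [s1 s2] := ss; pose n := size s; pose Y := xbar - \sum_(z <- s) z.
pose y : X := 2^-1 *: Y; pose hs : seq X := [seq 2^-1 *: z | z <- s].
pose F (t : bool) : set (dual X) :=
  if t then [set v n] else closure ((A `\ v n) : set (weak_star X)).
have loadE f : load hs f = 2^-1 * \sum_(z <- s) `|f z|.
  rewrite /load big_map mulr_sumr; apply: eq_bigr => z _.
  by rewrite dual_scale normrM ger0_norm ?invr_ge0.
have F_ball t f : F t f -> `|f| <= 1.
  case: t => [->|clf]; first exact/A_ball/v_A.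
  have [|//] := @weak_star_closure_norming _ _ (A `\ v n) xbar f _ clf.
  by move=> g [Ag _]; split; [exact: A_ball|exact: A_xbar].
have F_compact t : compact (F t : set (weak_star X)).
  case: t; first exact: compact_set1.
  apply: (@subclosed_compact (weak_star X) _ (unit_ball (dual X))).
  - exact: closed_closure.
  - exact: weak_star_ball_compact.
  - exact: (F_ball false).
have F_supp t f : F t f -> forall i, coord f i != 0 -> exists u, F u (e i) \/ F u (- e i).
  have sgn (g : dual X) a i u : `|a| = 1 -> g = a *: e i -> F u g -> F u (e i) \/ F u (- e i).
    move=> a1 -> Fa; have : `|a| == 1 by rewrite a1.
    rewrite eqr_norml ler01 andbT => /orP[]/eqP aE; rewrite aE in Fa; [left|right].
      by rewrite scale1r in Fa.
    by rewrite scaleN1r in Fa.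
  case: t => [-> i vi|clf i fi].
    by exists true; have [a1 vE] := face_sign (v_A n) vi; apply: (sgn (v n) _ _ _ a1 vE).
  have [a [a1 Aa anv]] := closure_face clf fi; exists false.
  by apply: (sgn _ _ _ _ a1 erefl); apply: subset_closure; split.
(* An index occurring in [A] must carry the signed indicator of [v n]; the others keep [e i y]. *)
have /choice[b bP] : forall i, exists r : R, `|r - e i y| + load hs (e i) <= 2^-1 /\
    forall f, A f -> coord f i != 0 -> coord f i * r = (f == v n)%:R.
  move=> i; have [[f [Af fi]]|nf] := pselect (exists f, A f /\ coord f i != 0); last first.
    exists (e i y); split; last by move=> f Af fi; case: nf; exists f.
    rewrite subrr normr0 add0r loadE; have := s1 i; have := normr_ge0 (e i Y); rewrite -/Y; lra.
  have [a1 fE] := face_sign Af fi; set a := coord f i in a1 fE.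
  have aa : a * a = 1 by rewrite -expr2 -real_normK ?num_real// a1 expr1n.
  exists (a * (f == v n)%:R); split; last first.
    by move=> g Ag gi; rewrite -(face_inj Af Ag fi gi) mulrA aa mul1r.
  have [k1 k2 /andP[k3 k4]] := splits_sum ss Af; set k := \sum_(j < _) _ in k1 k2 k3 k4.
  have eE z : e i z = a * f z by rewrite fE dualZE mulrA aa mul1r.
  have -> : load hs (e i) = 2^-1 * k.
    by rewrite loadE -k2; congr (_ * _); apply: eq_bigr => z _; rewrite eE normrM a1 mul1r.
  rewrite eE -mulrBr normrM a1 mul1r /y dual_scale /Y dual_sub dual_sum k1 A_xbar//.
  have [fv|fv] := eqVneq f (v n); last by rewrite sub0r normrN ger0_norm; lra.
  have -> : k = 0.
    rewrite /k big1// => j _; rewrite fv; apply/eqP; rewrite pnatr_eq0 eqb0.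
    by apply/eqP => /v_inj nj; have := ltn_ord j; rewrite -nj ltnn.
  by rewrite (_ : true%:R = 1 :> R)// ger0_norm; lra.
have b_load i : `|b i - e i y| + load hs (e i) <= 2^-1 by have [] := bP i.
have F_sum t f : F t f -> (fun m => \sum_(i < m) coord f i * b i) @ \oo --> (t%:R : R).
  case: t => [->|clf]; last first.
    rewrite (_ : (fun m => _) = cst 0); first exact: cvg_cst.
    apply/funext => m; rewrite big1// => i _.
    have [->|fi] := eqVneq (coord f i) 0; first by rewrite mul0r.
    have [a [a1 Aa anv]] := closure_face clf fi.
    have [_ /(_ _ Aa)] := bP i; rewrite coordZ coord_basis eqxx mulr1 -normr_gt0 a1.
    move=> /(_ ltr01); have /eqP/negbTE -> := anv => /eqP.
    by rewrite mulf_eq0 -normr_eq0 a1 oner_eq0/= => /eqP ->; rewrite mulr0.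
  have [a [i [a1 vE]]] := extreme_normingE xbar1 (v_A n).
  apply: cvg_near_cst; near=> m.
  have im : (i < m)%N by near: m; exact: nbhs_infty_gt.
  rewrite (bigD1 (Ordinal im))//= big1 ?addr0 => [|k].
    have [_ /(_ _ (v_A n))] := bP i; rewrite eqxx => -> //.
    by rewrite vE coordZ coord_basis eqxx mulr1 -normr_gt0 a1.
  by rewrite -val_eqE/= vE coordZ coord_basis => /negbTE ->; rewrite mulr0 mul0r.
have [x [x1 x2]] := extension F_compact F_ball F_supp b_load F_sum.
have absD (p q r : R) : `|p + q| <= r -> `|p - q| <= r -> `|p| + `|q| <= r.
  by rewrite !ler_norml; have [_|_] := ger0P p; have [_|_] := ger0P q; lra.
exists x; split.
  move=> i; rewrite -cats1 !big_cat !big_seq1 /= opprD addrA -/Y addrA -lerBrDr.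
  have := absD (e i (Y - x)) (e i x) (1 - \sum_(z <- s) `|e i z|).
  have s1i : `|e i Y| <= 1 - \sum_(z <- s) `|e i z| by rewrite lerBrDr; exact: s1.
  rewrite -dual_add subrK => /(_ s1i).
  suff h : `|e i (Y - x) - e i x| <= 1 - \sum_(z <- s) `|e i z| by move=> /(_ h); lra.
  have := x1 (e i); rewrite basis_norm lexx loadE => /(_ isT).
  have -> : e i (x - y) = e i x - 2^-1 * e i Y by rewrite /y dual_sub dual_scale.
  have -> : e i (Y - x) = e i Y - e i x by exact: dual_sub.
  by rewrite -lerBrDr !ler_norml; lra.
move=> f Af j; rewrite size_rcons ltnS leq_eqVlt => /orP[/eqP ->|js].
  rewrite nth_rcons ltnn eqxx; have [fv|fv] := eqVneq f (v (size s)).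
    exact: (x2 true).
  by apply: (x2 false); apply: subset_closure; split=> //; exact/eqP.
by rewrite nth_rcons js; exact: s2.
Unshelve. all: by end_near. Qed.

Theorem face_copy : exists T : {linear cseq R -> X}, isometric T.
Proof.
have /choice[next nextP] : forall s, exists x, splits s -> splits (rcons s x).
  move=> s; have [ss|nss] := pselect (splits s); last by exists 0.
  by have [x sx] := splits_rcons ss; exists x.
pose st := fix st n : seq X := if n is m.+1 then rcons (st m) (next (st m)) else [::].
pose x n := next (st n).
have stE n : st n = [seq x j | j <- iota 0 n].
  elim: n => [//|n IH]; rewrite -addn1 iotaD map_cat addn1/= add0n -/(x n) -IH.
  by rewrite cats1.
have st_splits n : splits (st n).
  elim: n => [|n IH]; last exact: nextP.
  split=> // i; rewrite !big_nil subr0 addr0.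
  by rewrite (le_trans (basis_le i xbar))// xbar1.
apply: (@copy_of_c _ _ e norm_le_basis xbar v x) => //.
- by move=> k; exact/A_ball/v_A.
- move=> k j; have [_ /(_ _ (v_A k) j)] := st_splits j.+1.
  rewrite stE size_map size_iota (nth_map 0%N) ?size_iota// nth_iota// add0n.
  by rewrite (inj_eq v_inj); apply.
- move=> n i; have [/(_ i) + _] := st_splits n.
  have sumE (V : nmodType) (G : nat -> V) : \sum_(j <- iota 0 n) G j = \sum_(j < n) G j.
    by rewrite -(big_mkord xpredT) /index_iota subn0.
  by rewrite stE !big_map !sumE.
Qed.

End FaceToCopy.

(** Helly's theorem almost realizes each finite sign pattern; a nonzero [f] with most of its norm on
    finitely many coordinates cannot vanish at the element with its signs. *)
Lemma countable_total : exists z : nat -> X,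
  forall f, (forall j, f (z j) = 0) -> f = 0.
Proof.
have /choice[zs zsP] : forall s : seq bool, exists x, `|x| <= 1 + 4%:R^-1 /\
    forall i, (i < size s)%N -> `|e i x - (if nth false s i then 1 else -1)| <= 4%:R^-1.
  move=> s;
  have [||x x1 xs] := @helly (fun i => if nth false s i then 1 else -1) (size s) 1 4%:R^-1.
  - by rewrite invr_gt0.
  - by move=> i; case: ifP; rewrite ?normrN normr1.
  by exists x.
exists (fun j => if unpickle j is Some s then zs s else 0) => f f0.
have {}f0 s : f (zs s) = 0 by have := f0 (pickle s); rewrite pickleK.
apply/eqP; apply: contraPT (lexx (0 : R)) => fn0; apply/negP; rewrite -ltNge.
have nf : 0 < `|f| by rewrite normr_gt0.
(* With at most a quarter of the norm beyond [n], vanishing would give [9/16 <= 5/16] after division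
   by [|f|]. *)
have [n fn] : exists n, `|f| - \sum_(i < n) `|coord f i| <= `|f| / 4%:R.
  have f4 : 0 < `|f| / 4%:R by rewrite divr_gt0.
  have /cvgrPdist_le/(_ _ f4)/filter_ex[n fn] := @sum_coord_cvg f.
  by exists n; rewrite (le_trans (ler_norm _)).
pose s := mkseq (fun i => 0 <= coord f i) n.
have [zs1 zs2] := zsP s; have fz := f0 s.
have := eval_partial f (zs s) n; rewrite fz sub0r normrN => h1.
have h2 : \sum_(i < n) coord f i * e i (zs s) >= 3%:R / 4%:R * \sum_(i < n) `|coord f i|.
  rewrite mulr_sumr; apply: ler_sum => i _.
  have := zs2 i; rewrite size_mkseq ltn_ord nth_mkseq// => /(_ isT).
  rewrite ler_distl; have [c0|c0] := leP 0 (coord f i) => /andP[].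
    by rewrite ger0_norm//; nra.
  by rewrite ltr0_norm//; nra.
have h3 : `|f - partial f n| * `|zs s| <= `|f| / 4%:R * (1 + 4%:R^-1).
  by apply: ler_pM => //; exact: le_trans (partial_norm f n) fn.
have := ler_norm (\sum_(i < n) coord f i * e i (zs s)); lra.
Qed.

(** * From a copy of [c] to a face satisfying the conditions *)

Section CopyToFace.
Variable T : {linear cseq R -> X}.
Hypothesis T_isometric : isometric T.

Lemma indicator_cvg (D : pred nat) : (exists N, forall j, (N <= j)%N -> D j = D N) ->
  (fun j => (D j)%:R : R^o) \in @convergent_seq R.
Proof.
move=> [N DN]; apply/convergent_seqP; apply/(cvgP ((D N)%:R : R^o)); apply: cvg_near_cst.
by exists N => // j /= Nj; rewrite DN.
Qed.

Lemma tail_cvg N : (fun j => (N <= j)%N%:R : R^o) \in @convergent_seq R.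
Proof. by apply: indicator_cvg; exists N => j ->; rewrite leqnn. Qed.

Lemma unit_cvg n : (fun j => (j == n)%:R : R^o) \in @convergent_seq R.
Proof. by apply: indicator_cvg; exists n.+1 => j nj; rewrite !gtn_eqF. Qed.

Definition tail N : X := T (Cseq (tail_cvg N)).

Lemma T_le f (w : cseq R) : `|f| <= 1 -> (forall j, `|w j : R| <= 1) -> `|f (T w)| <= 1.
Proof.
move=> f1 w1; apply: le_trans (dual_norm_bound _ _) _.
by rewrite -[1]mulr1 ler_pM// T_isometric; exact: cseq_norm_le.
Qed.

Lemma tail_norm N : `|tail N| <= 1.
Proof.
rewrite T_isometric; apply: cseq_norm_le => j /=.
by rewrite normr_nat lern1 leq_b1.
Qed.

(** A functional of the ball with value 1 at [T d] kills every [T w] with [|d + w|] and [|d - w|] at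
    most 1. For [n < N] take for [w] the indicator of [[N, oo[], otherwise that indicator minus
    [d]. *)
Lemma tail_functional n : exists f, extreme_points (unit_ball (dual X)) f /\
  forall N, f (tail N) = (N <= n)%N%:R.
Proof.
pose d := Cseq (unit_cvg n).
have Td : `|T d| = 1.
  rewrite T_isometric; apply/eqP; rewrite eq_le; apply/andP; split.
    by apply: cseq_norm_le => j /=; rewrite normr_nat lern1 leq_b1.
  by have := cseq_norm_ub d n; rewrite /= eqxx normr1.
have [i ei] := norm_attained (T d); rewrite Td in ei.
pose a := e i (T d); exists (a *: e i); split; first exact: basis_extreme.
set f := a *: e i.
have f1 : `|f| <= 1 by rewrite normrZ ei basis_norm mulr1.
have fd : f (T d) = 1 by rewrite dualZE -/a -expr2 -real_normK ?num_real// ei expr1n.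
have f0 (w : cseq R) : (forall j, `|d j + w j : R| <= 1) ->
    (forall j, `|d j - w j : R| <= 1) -> f (T w) = 0.
  move=> w1 w2; have := T_le (w := d + w) f1 w1; have := T_le (w := d - w) f1 w2.
  rewrite (linearB T) (linearD T) dual_sub dual_add fd !ler_norml; lra.
move=> N; have [Nn|nN] := leqP N n; last first.
  by apply: f0 => j /=; have [->|jn] := eqVneq j n;
    rewrite ?(leqNgt N n) ?nN ?addr0 ?subr0 ?normr1// ?add0r ?sub0r ?normrN normr_nat lern1 leq_b1.
suff : f (T (Cseq (tail_cvg N) - d)) = 0.
  by rewrite linearB dual_sub fd => /eqP; rewrite subr_eq0 => /eqP.
apply: f0 => j.
  rewrite -[X in `|X|]/((j == n)%:R + ((N <= j)%N%:R - (j == n)%:R)) addrC subrK.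
  by rewrite normr_nat lern1 leq_b1.
rewrite -[X in `|X|]/((j == n)%:R - ((N <= j)%N%:R - (j == n)%:R)).
have [->|_] := eqVneq j n; first by rewrite Nn subrr subr0 normr1.
by rewrite subr0 sub0r normrN normr_nat lern1 leq_b1.
Qed.

(** The face [W] of the outline. The functional given by [tail_functional n] violates its condition
    at [N = n.+1]. *)
Definition limit_face : set (dual X) := [set f : dual X | `|f| <= 1 /\ forall N, f (tail N) = 1].

Theorem copy_face : exists (xbar : X) (v : nat -> dual X) (xstar : dual X),
  [/\ unit_sphere X xbar,
      injective v,
      (forall n, extreme_points (unit_ball (dual X)) (v n)) &
      [/\ weak_star_cvg v xstar,
          (forall n, v n xbar = 1) /\ xstar xbar = 1 &
          forall n (d : dual X),
            weak_star_cluster_points (extreme_points (norming xbar)) d ->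
            supp (J (v n)) `&` supp (J d) = set0]].
Proof.
have /choice[v vP] := tail_functional.
have v_ext n : extreme_points (unit_ball (dual X)) (v n) by have [] := vP n.
have v_tail n N : v n (tail N) = (N <= n)%N%:R by have [] := vP n.
have v_ball n : `|v n| <= 1 by have [] := v_ext n.
have v_inj : injective v.
  have le n m : v n = v m -> (n <= m)%N.
    move=> vnm; have := v_tail m n; rewrite -vnm v_tail leqnn => /eqP.
    by rewrite eqr_nat; case: (n <= m)%N.
  by move=> n m vnm; apply/eqP; rewrite eqn_leq !le.
pose F : set (dual X) := limit_face `|` range v.
have F_ball f : F f -> `|f| <= 1 by case=> [[]//|[n _ <-]].
have F_tail0 f : F f -> f (tail 0) = 1 by case=> [[_ ->//]|[n _ <-]]; rewrite v_tail.
(* Weak-star closed sets that allow only finitely many exceptions [v j] to the condition at [N]. *)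
pose G N m : set (weak_star X) := [set f | (f : dual X) (tail N) = 1] `|` (v @` `I_m).
have FG N : F `<=` G N N.
  move=> f [[_ fN]|[n _ <-]]; first by left; exact: fN.
  have [Nn|nN] := leqP N n; first by left; rewrite /= v_tail Nn.
  by right; exists n.
have G_closed N m : closed (G N m).
  apply: closedU.
    apply: (@preimage_closed (weak_star X) R^o (fun g => (g : dual X) (tail N)) [set r | r = 1]).
      by move=> g _; exact: weak_star_eval_continuous.
    exact: (@closed_eq R).
  apply: compact_closed; first exact: weak_star_hausdorff.
  by apply: finite_compact; apply: finite_image; exact: finite_II.
(* A limit violating the condition at [N] must be some [v j] with [j < N]. *)
have F_closed : closed (F : set (weak_star X)).
  move=> f clf; have f1 : `|f| <= 1.
    by apply: weak_star_ball_closed; apply: closureS clf.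
  have [fW|/existsNP[N fN]] := pselect (forall N, (f : dual X) (tail N) = 1); first by left.
  have [//|[n _ <-]] : G N N f by apply: G_closed; apply: closureS clf; exact: FG.
  by right; exists n.
have F_compact : compact (F : set (weak_star X)).
  apply: (@subclosed_compact (weak_star X) _ (unit_ball (dual X))) => //.
  exact: weak_star_ball_compact.
have limit_supp f i : limit_face f -> coord f i != 0 ->
    let a := coord f i / `|coord f i| in `|a| = 1 /\ limit_face (a *: e i).
  move=> [f1 ftail] fi a; have nfi : `|coord f i| != 0 by rewrite normr_eq0.
  have a1 : `|a| = 1 by rewrite normrM normfV normr_id mulfV.
  split=> //; split; first by rewrite normrZ a1 basis_norm mulr1.
  move=> N; rewrite dualZE /a mulrAC norming_coord ?mulfV// => k.
  exact: le_trans (basis_le k _) (tail_norm N).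
have tail0 : `|tail 0| = 1.
  apply/eqP; rewrite eq_le tail_norm/=; have := dual_norm_bound (v 0%N) (tail 0).
  by rewrite v_tail normr1 => /le_trans; apply; rewrite ler_piMl.
have v_basis n : exists a i, `|a| = 1 /\ v n = a *: e i.
  by apply: (@extreme_normingE (tail 0)) => //; apply: extreme_norming; rewrite ?v_tail.
have F_supp f i : F f -> coord f i != 0 ->
    let a := coord f i / `|coord f i| in `|a| = 1 /\ F (a *: e i).
  move=> [fW|[n _ <-]] fi; first by have [a1 aW] := limit_supp f i fW fi; split=> //; left.
  have [a [k [a1 vE]]] := v_basis n; move: fi; rewrite vE coordZ coord_basis.
  have [->|_] := eqVneq i k; last by rewrite mulr0 eqxx.
  by rewrite mulr1 a1 divr1 => _; split=> //; right; exists n.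
(* The sign with which [e i] occurs in [F] is fixed by the common value 1 at [tail 0]. *)
have F_sign f i a : F f -> coord f i != 0 -> F (a *: e i) ->
    coord f i * a = `|coord f i|.
  move=> Ff fi Fa; have [b1] := F_supp f i Ff fi; set b := _ / _ in b1 * => Fb.
  have := F_tail0 _ Fa; have := F_tail0 _ Fb; rewrite !dualZE => bE aE.
  have t0 : e i (tail 0) != 0 by apply: contra_eqN aE => /eqP ->; rewrite mulr0 eq_sym oner_eq0.
  have -> : a = b by apply: (mulIf t0); rewrite aE bE.
  rewrite /b mulrA -expr2 -real_normK ?num_real// expr2 mulfK//.
  by rewrite normr_eq0.
pose bad k := ~ F (e k) /\ ~ F (- e k).
(* For bad [k], [extension] with [y = 0], empty load and radius 1 prescribes 1 on [F] and 0 at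
   [e k]; for the other indices [tail 0] serves. *)
have peak k : exists x, [/\ `|x| <= 1, forall f, F f -> f x = 1 & bad k -> e k x = 0].
  have [[nF nF']|gk] := pselect (bad k); last first.
    by exists (tail 0); split=> //; exact: tail_norm.
  have nFa a : `|a| = 1 -> ~ F (a *: e k).
    move=> a1; have : `|a| == 1 by rewrite a1.
    by rewrite eqr_norml ler01 andbT => /orP[]/eqP ->; rewrite ?scale1r ?scaleN1r.
  pose FF (t : bool) : set (dual X) := if t then F else [set e k].
  (* [b] is the sign pattern of [F], and 0 at the indices missing from [F], among them [k]. *)
  have /choice[b bP] : forall i, exists r : R, [/\ `|r| <= 1,
      forall f, F f -> coord f i * r = `|coord f i| & i = k -> r = 0].
    move=> i; have [[f [Ff fi]]|nf] := pselect (exists f, F f /\ coord f i != 0).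
      have [a1 Fa] := F_supp f i Ff fi; set a := _ / _ in a1 Fa.
      exists a; split; first by rewrite a1.
        move=> g Fg; have [->|gi] := eqVneq (coord g i) 0; first by rewrite mul0r normr0.
        exact: F_sign.
      by move=> ik; rewrite ik in Fa; have /(_ Fa) := nFa _ a1.
    exists 0; split=> // [|f Ff]; first by rewrite normr0.
    have [->|fi] := eqVneq (coord f i) 0; first by rewrite mul0r normr0.
    by case: nf; exists f.
  have FF_compact t : compact (FF t : set (weak_star X)) by case: t => //; exact: compact_set1.
  have FF_ball t f : FF t f -> `|f| <= 1.
    by case: t => [/F_ball//|->]; rewrite basis_norm.
  have FF_supp t f : FF t f -> forall i, coord f i != 0 -> exists u, FF u (e i) \/ FF u (- e i).
    case: t => [Ff i fi|-> i].
      have [a1 Fa] := F_supp f i Ff fi; set a := _ / _ in a1 Fa; exists true.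
      have : `|a| == 1 by rewrite a1.
      rewrite eqr_norml ler01 andbT => /orP[]/eqP aE; rewrite aE in Fa; [left|right].
        by rewrite scale1r in Fa.
      by rewrite scaleN1r in Fa.
    rewrite coord_basis; have [->|_] := eqVneq i k; last by rewrite eqxx.
    by exists false; left.
  have b_load i : `|b i - e i 0| + load [::] (e i) <= 1.
    by rewrite linear0 subr0 /load big_nil addr0; have [] := bP i.
  have FF_sum t f : FF t f -> (fun m => \sum_(i < m) coord f i * b i) @ \oo --> (t%:R : R).
    case: t => [Ff|->].
      rewrite (_ : (fun m => _) = (fun m => \sum_(i < m) `|coord f i|)); last first.
        by apply/funext => m; apply: eq_bigr => i _; have [_ ->] := bP i.
      have <- : `|f| = 1; last exact: sum_coord_cvg.
      apply/eqP; rewrite eq_le F_ball//=; have := dual_norm_bound f (tail 0).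
      rewrite F_tail0// normr1; have := tail_norm 0; have := normr_ge0 f; nra.
    rewrite (_ : (fun m => _) = cst 0); first exact: cvg_cst.
    apply/funext => m; rewrite big1// => i _; rewrite coord_basis.
    have [ik|_] := eqVneq (i : nat) k; last by rewrite mul0r.
    by have [_ _ ->] := bP i; rewrite ?mulr0.
  have [x [x1 x2]] := extension FF_compact FF_ball FF_supp b_load FF_sum.
  exists x; split; [|exact: (x2 true)|move=> _; exact: (x2 false)].
  apply: norm_le_basis => i; have := x1 (e i); rewrite basis_norm lexx => /(_ isT).
  by rewrite /load big_nil addr0 subr0.
have /choice[p pP] := peak.
pose h : R := 2^-1.
have hn0 n : 0 < h ^+ n by rewrite exprn_gt0 ?invr_gt0.
(* At a bad index [i], the vanishing of [e i (p i)] costs the weight [h ^+ i.+1], so the average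
   satisfies [|e i xbar| < 1]. *)
pose s n : X := \sum_(k < n) h ^+ k.+1 *: p k.
have sum_h n : \sum_(k < n) h ^+ k.+1 = 1 - h ^+ n.
  elim: n => [|n IH]; first by rewrite big_ord0 expr0 subrr.
  by rewrite big_ord_recr/= IH exprS /h; lra.
have s_cvg : cvgn s.
  apply: (@geometric_step_cvg _ _ _ 1) => n.
  have -> : s n.+1 - s n = h ^+ n.+1 *: p n by rewrite /s big_ord_recr/= addrAC subrr add0r.
  rewrite normrZ gtr0_norm// mul1r.
  have [p1 _ _] := pP n; have := hn0 n; rewrite exprS -/h /h; have := normr_ge0 (p n); nra.
pose xbar := limn s.
have ev f : (fun n => f (s n)) @ \oo --> f xbar.
  by apply: continuous_cvg => //; exact: dual_continuous.
have evE f n : f (s n) = \sum_(k < n) h ^+ k.+1 * f (p k).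
  by rewrite dual_sum; apply: eq_bigr => k _; rewrite dual_scale.
have h0 : (fun n => h ^+ n) @ \oo --> (0 : R).
  by apply: cvg_expr; rewrite gtr0_norm ?invr_gt0// invf_lt1 ?ltr1n.
have F_xbar f : F f -> f xbar = 1.
  move=> Ff; apply: (@cvg_unique _ (@Rhausdorff R)) (ev f) _.
  have fs : (fun n => f (s n)) = (fun n => 1 - h ^+ n).
    apply/funext => n; rewrite evE -sum_h; apply: eq_bigr => k _.
    by have [_ pF _] := pP k; rewrite pF// mulr1.
  by have := cvgB (cvg_cst (1 : R)) h0; rewrite subr0 fs; exact.
have e_p i k : `|e i (p k)| <= 1.
  by have [p1 _ _] := pP k; exact: le_trans (basis_le i _) p1.
have basis_xbar i c : (forall n, (i < n)%N -> \sum_(k < n) h ^+ k.+1 * `|e i (p k)| <= c) ->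
    `|e i xbar| <= c.
  move=> hc; apply: (cvgr_to_le (cvg_norm (ev (e i)))); near=> n.
  rewrite evE; apply: le_trans (ler_norm_sum _ _ _) _.
  apply: le_trans (hc n _); last by near: n; exact: nbhs_infty_gt.
  by apply: ler_sum => k _; rewrite normrM gtr0_norm.
have xbar_le1 : `|xbar| <= 1.
  apply: norm_le_basis => i; apply: basis_xbar => n _.
  apply: (@le_trans _ _ (\sum_(k < n) h ^+ k.+1)).
    by apply: ler_sum => k _; rewrite ler_piMr// ltW.
  by rewrite sum_h gerBl ltW.
have bad_lt i : bad i -> `|e i xbar| < 1.
  move=> bi; apply: (@le_lt_trans _ _ (1 - h ^+ i.+1)); last by rewrite gtrBl.
  apply: basis_xbar => n ni; have := sum_h n; rewrite (bigD1 (Ordinal ni))//= => E.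
  rewrite (bigD1 (Ordinal ni))//=; have [_ _ -> //] := pP i; rewrite normr0 mulr0 add0r.
  apply: (@le_trans _ _ (\sum_(k < n | k != Ordinal ni) h ^+ k.+1)).
    by apply: ler_sum => k _; rewrite ler_piMr// ltW.
  have := hn0 n; lra.
have v_xbar n : v n xbar = 1 by apply: F_xbar; right; exists n.
have xbar1 : `|xbar| = 1.
  apply/eqP; rewrite eq_le xbar_le1/=; have := dual_norm_bound (v 0%N) xbar.
  by rewrite v_xbar normr1 => /le_trans; apply; rewrite ler_piMl.
pose A := extreme_points (norming xbar).
(* An extreme norming functional is a signed [e i] of value 1 at [xbar], so [i] is not bad, and the
   sign is the one occurring in [F]. *)
have AF : A `<=` F.
  move=> f Af; have [a [i [a1 fE]]] := extreme_normingE xbar1 Af.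
  have fx : a * e i xbar = 1 by have [/(normingP _ xbar1)[_]] := Af; rewrite fE.
  have : ~ bad i.
    move=> /bad_lt; have -> : `|e i xbar| = `|a * e i xbar| by rewrite normrM a1 mul1r.
    by rewrite fx normr1 ltxx.
  move=> /not_andP[/contrapT Fi|/contrapT Fi]; have := F_xbar _ Fi.
    by move=> ex; rewrite fE; rewrite ex mulr1 in fx; rewrite fx scale1r.
  rewrite -[(- e i) xbar]/(- e i xbar) => /eqP; rewrite eqr_oppLR => /eqP ex.
  rewrite ex mulrN1 in fx; rewrite fE (_ : a = -1) ?scaleN1r//.
  by rewrite -fx opprK.
have cluster_limit d : weak_star_cluster_points A d -> limit_face d.
  move=> dA; have : F d.
    apply: F_closed; apply: closureS (subset_limit_point dA); exact: AF.
  (* If the cluster point is [v m], the other elements of [A] lie in [G m.+1 m], which is closed and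
     excludes [v m]. *)
  move=> [//|[m _ vm]]; have : G m.+1 m d.
    apply: G_closed => U /dA[f [/eqP fd Af Uf]]; exists f; split=> //.
    have [[_ fN]|[n _ vn]] := AF _ Af; first by left; exact: fN.
    have [mn|nm|nm] := ltngtP m n.
    - by left; rewrite /= -vn v_tail mn.
    - by right; exists n.
    - by case: fd; rewrite -vn -nm.
  move=> [/=|[n /= nm vn]]; rewrite -vm.
    by rewrite v_tail ltnn => /eqP; rewrite eq_sym oner_eq0.
  by move: vn; rewrite -vm => /v_inj nE; rewrite nE ltnn in nm.
(* Weak-star convergence is reached by passing to a subsequence, which keeps the other
   properties. *)
have [z z_total] := countable_total.
have [sg [xstar [sg_lt xstarP]]] := weak_star_subsequence z_total v_ball.
exists xbar, (v \o sg), xstar; split => //.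
- apply: inj_comp v_inj _ => n m nm; have sgm := homo_ltn ltn_trans sg_lt.
  by have [/sgm|/sgm|//] := ltngtP n m; rewrite nm ltnn.
- by move=> n; exact: v_ext.
split => //.
- split=> [n|]; first exact: v_xbar.
  have /weak_star_cvgP/(_ xbar) := xstarP.
  move=> xs; apply: (@cvg_unique _ (@Rhausdorff R)) xs _.
  suff : (fun n => v (sg n) xbar) @ \oo --> (1 : R) by exact.
  by rewrite (_ : (fun n => _) = cst 1); [exact: cvg_cst|apply/funext => n; exact: v_xbar].
(* A common index would put [v (sg n)] itself in the limit face, against its value 0 at
   [tail (sg n).+1]. *)
- move=> n d /cluster_limit dW; apply/seteqP; split=> // i [/= vi di].
  have [a1 aW] := limit_supp d i dW di; set a := _ / _ in a1 aW.
  have Fv : F (v (sg n)) by right; exists (sg n).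
  have va := F_sign (v (sg n)) i a Fv vi (or_introl aW).
  have [b [k [b1 vE]]] := v_basis (sg n).
  have va' : v (sg n) = a *: e i.
    have vi' : coord (v (sg n)) i != 0 by exact: vi.
    move: vi' va; rewrite vE coordZ coord_basis.
    have [->|_] := eqVneq i k; last by rewrite mulr0 eqxx.
    rewrite mulr1 b1 => _ ba; congr (_ *: _).
    have aa : a * a = 1 by rewrite -expr2 -real_normK ?num_real// a1 expr1n.
    by rewrite -[LHS]mulr1 -aa mulrA ba mul1r.
  have [_ /(_ (sg n).+1)] := aW; rewrite -va' v_tail ltnn => /eqP.
  by rewrite eq_sym oner_eq0.
Unshelve. all: by end_near. Qed.

End CopyToFace.

End Predual.

(** The identification of the dual with [l_1] is the bijective isometry [J]; [injective v] records
    that the sequence consists of distinct functionals. *)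
Theorem theorem4p3 (R : realType) (X : completeNormedModType R)
    (J : {linear dual X -> l1 R}) (J_isometric : isometric J)
    (J_bijective : bijective J) :
  (exists T : {linear cseq R -> X}, isometric T)
  <->
  (exists (xbar : X) (v : nat -> dual X) (xstar : dual X),
    [/\ unit_sphere X xbar,
        injective v,
        (forall n, extreme_points (unit_ball (dual X)) (v n)) &
        [/\ weak_star_cvg v xstar,
            (forall n, v n xbar = 1) /\ xstar xbar = 1 &
            forall n (d : dual X),
              weak_star_cluster_points (extreme_points (norming xbar)) d ->
              supp (J (v n)) `&` supp (J d) = set0]]).
Proof.
split=> [[T T_isometric]|[xbar [v [_ [xbar1 v_inj v_ext [_ [v_xbar _] v_supp]]]]]].
  exact: copy_face J_isometric J_bijective T T_isometric.
exact: (face_copy J_isometric J_bijective xbar1 v_inj v_ext v_xbar v_supp).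
Qed.
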